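(* Let $d\ge2$, let $(U_n)_{n\ge 0}$ be the infinite color urn model associated with a random walk on $\mathbb{Z}^d$ with bounded i.i.d. increments $(X_j)_{j\ge1}$, where the matrix $\varSigma:=\mathbf{E}[X_1^TX_1]$ is positive definite, and let $Z_n$ be the $(n+1)$-th selected color. Suppose the initial configuration $U_0=(U_{0,\mathbf{v}})_{\mathbf{v}\in\mathbb{Z}^d}$ (a probability distribution) is such that $U_{0,\mathbf{v}}=0$ for all but finitely many $\mathbf{v}\in\mathbb{Z}^d$. Then there exists a constant $C>0$ (which may depend on the increment distribution and on $U_0$, but not on $n$) such that for every $n\ge2$, $$\sup_{\mathbf{x}\in\mathbb{R}^d}\left|\mathbf{P}\left(\left(\frac{Z_n-\boldsymbol{\mu}\log n}{\sqrt{\log n}}\right)\varSigma^{-1/2}\le\mathbf{x}\right)-\Phi_d(\mathbf{x})\right|\le C\times\frac{\rho_3^{(d)}}{\sqrt{n}\,\big(\rho_2^{(d)}\big)^{3/2}},$$ and $$\frac{\rho_3^{(d)}}{\sqrt{n}\,\big(\rho_2^{(d)}\big)^{3/2}}=\mathcal{O}\left(\frac{1}{\sqrt{\log n}}\right)\quad\text{as }n\to\infty,$$ where $\Phi_d$ is the distribution function of a standard $d$-dimensional normal random vector.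
   Context: All vectors are row vectors; $\mathbf{x}^T$ is the column vector. Coordinates of $\mathbf{x}\in\mathbb{R}^d$ are $(x^{(1)},\dots,x^{(d)})$, and $\mathbf{x}\le\mathbf{y}$ means coordinatewise inequality. For a positive definite matrix $B$, $B^{1/2}$ is its unique positive definite square root. For a $d\times d$ matrix $A$, $A(i,j)$ denotes the $(d-1)\times(d-1)$ submatrix obtained by deleting row $i$ and column $j$. Let $(X_j)_{j\ge1}$ be i.i.d. random vectors in $\mathbb{Z}^d$ with probability mass function $p(\mathbf{u}):=\mathbf{P}(X_1=\mathbf{u})$; the increments are bounded, i.e. there is a finite nonempty $B\subseteq\mathbb{Z}^d$ with $p(\mathbf{u})=0$ for all $\mathbf{u}\notin B$. Write $\boldsymbol{\mu}:=\mathbf{E}[X_1]$, $\varSigma:=\mathbf{E}[X_1^TX_1]$ (uncentered) and $M:=\big(\mu^{(i)}\mu^{(j)}\big)_{1\le i,j\le d}$. Define $$\rho_2^{(d)}:=\frac1n\sum_{j=1}^n\frac{1}{j+1}\,\frac{\det\left(\varSigma-\frac{1}{j+1}M\right)}{\det\left(\varSigma(1,1)-\frac{1}{j+1}M(1,1)\right)},\qquad \rho_3^{(d)}:=\frac{1}{nd}\sum_{j=1}^n\sum_{i=1}^d\gamma_n^3(i)\,\beta_j(i),$$ where $\gamma_n(i)\geq 0$ is given by $$\gamma_n^2(i):=\max_{1\le j\le n}\frac{\det\left(\varSigma(i,i)-\frac{1}{j+1}M(i,i)\right)}{\det\left(\varSigma(1,1)-\frac{1}{j+1}M(1,1)\right)},$$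 and $$\beta_j(i):=\frac{1}{j+1}\mathbf{E}\left[\left|X_1^{(i)}-\frac{\mu^{(i)}}{j+1}\right|^3\right]+\frac{j}{(j+1)^4}\left|\mu^{(i)}\right|^3 .$$ Infinite color urn model associated with the random walk: colors are indexed by $\mathbb{Z}^d$. Let $R$ be the transition matrix of the random walk with increments $(X_j)$, so that the $\mathbf{v}$-th row $R_{\mathbf{v}}$ of $R$ has $\mathbf{u}$-th entry $p(\mathbf{u}-\mathbf{v})$. The initial configuration $U_0=(U_{0,\mathbf{v}})_{\mathbf{v}\in\mathbb{Z}^d}$ is a probability distribution on $\mathbb{Z}^d$. Given $U_0,\dots,U_n$, a random color $Z_n$ (the $(n+1)$-th selected color) is chosen with $\mathbf{P}(Z_n=\mathbf{v}\mid U_n,\dots,U_0)=U_{n,\mathbf{v}}/(n+1)$, and then $U_{n+1}:=U_n+R_{Z_n}$. (Note $\sum_{\mathbf{v}}U_{n,\mathbf{v}}=n+1$.) *)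

(* Defs.v *)
(* MathComp-Analysis development over an abstract [R : realType]. *)
From HB Require Import structures.
From mathcomp Require Import all_boot all_order all_algebra.
From mathcomp Require Import all_classical all_reals all_analysis.

Set Implicit Arguments.
Unset Strict Implicit.
Unset Printing Implicit Defensive.

Import Order.TTheory GRing.Theory Num.Theory.
Import numFieldNormedType.Exports.

Local Open Scope classical_set_scope.
Local Open Scope ring_scope.

Definition posdefmx (R : realType) (d : nat) (A : 'M[R]_d) : Prop :=
  A^T = A /\ forall v : 'rV[R]_d, v != 0 -> 0 < (v *m A *m v^T) 0 0.

(* The positive definite square root; [0] only if there is none. *)
Definition sqrtmx (R : realType) (d : nat) (A : 'M[R]_d) : 'M[R]_d :=
  xget 0 [set S | posdefmx S /\ S *m S = A].

Definition delmx (R : realType) (d : nat) (i j : 'I_d) (A : 'M[R]_d) :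
  'M[R]_d.-1 := row' i (col' j A).

Definition vec_of_int (R : realType) (d : nat) (u : 'rV[int]_d) : 'rV[R]_d :=
  map_mx intr u.
Arguments vec_of_int R {d} u.

(* A standard normal vector has independent N(0,1) coordinates, so its
   distribution function is the product of the one-dimensional ones. *)
Definition std_normal_cdf (R : realType) (d : nat) (x : 'rV[R]_d) : R :=
  \prod_(i < d) fine (normal_prob 0 1 `]-oo, x 0 i]).

(* Since 'rV[int]_d is countable, it carries its power set as sigma-algebra:
   measurability is required on singletons, independence and equality of laws
   on arbitrary sets. *)
Definition discrete_rv (dT : measure_display) (T : measurableType dT)
    (d : nat) (X : T -> 'rV[int]_d) : Prop :=
  forall u, measurable (X @^-1` [set u]).

Definition iid (R : realType) (dT : measure_display) (T : measurableType dT)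
    (P : probability T R) (d : nat) (X : nat -> T -> 'rV[int]_d) : Prop :=
  [/\ forall j, discrete_rv (X j),
      forall j (A : set 'rV[int]_d), P (X j @^-1` A) = P (X 0%N @^-1` A) &
      forall (J : seq nat) (A : nat -> set 'rV[int]_d), uniq J ->
        P (\bigcap_(j in [set` J]) (X j @^-1` A j)) =
        (\prod_(j <- J) P (X j @^-1` A j))%E].

Section increment.
Context (R : realType) (dT : measure_display) (T : measurableType dT).
Context (P : probability T R) (d : nat) (X1 : T -> 'rV[int]_d).

Definition increment_pmf (u : 'rV[int]_d) : R := fine (P (X1 @^-1` [set u])).

Definition bounded_increment : Prop :=
  exists B : set 'rV[int]_d,
    [/\ finite_set B, B !=set0 & forall u, ~ B u -> increment_pmf u = 0].

Definition mean_vec : 'rV[R]_d :=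
  \row_i fine ('E_P[fun w => vec_of_int R (X1 w) 0%R i])%E.

Definition second_moment_mx : 'M[R]_d :=
  \matrix_(i, j) fine ('E_P[fun w =>
    ((vec_of_int R (X1 w))^T *m vec_of_int R (X1 w))%R i j])%E.

Definition mean_mx : 'M[R]_d := \matrix_(i, j) (mean_vec 0 i * mean_vec 0 j).

Definition shifted_mx (j : nat) : 'M[R]_d :=
  second_moment_mx - j.+1%:R^-1 *: mean_mx.

(* [det (Sigma(i,i) - M(i,i) / (j+1))]. *)
Definition shifted_minor (i : 'I_d) (j : nat) : R :=
  \det (delmx i i second_moment_mx - j.+1%:R^-1 *: delmx i i mean_mx).

(* In [rho2], [gamma_coef] and [rho3], [i1] is the first coordinate. *)
Definition rho2 (i1 : 'I_d) (n : nat) : R :=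
  n%:R^-1 *
  \sum_(1 <= j < n.+1) j.+1%:R^-1 * (\det (shifted_mx j) / shifted_minor i1 j).

(* Starting the iteration from the [j = 1] term makes it the maximum over
   [1 <= j <= n] as soon as [1 <= n]. *)
Definition gamma_coef (i1 : 'I_d) (n : nat) (i : 'I_d) : R :=
  Num.sqrt (\big[Num.max/shifted_minor i 1 / shifted_minor i1 1]_(1 <= j < n.+1)
              (shifted_minor i j / shifted_minor i1 j)).

Definition beta_coef (j : nat) (i : 'I_d) : R :=
  j.+1%:R^-1 *
    fine ('E_P[fun w =>
      (`|vec_of_int R (X1 w) 0 i - mean_vec 0 i / j.+1%:R| ^+ 3)%R])%E
  + j%:R / j.+1%:R ^+ 4 * `|mean_vec 0 i| ^+ 3.

Definition rho3 (i1 : 'I_d) (n : nat) : R :=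
  (n%:R * d%:R)^-1 *
  \sum_(1 <= j < n.+1) \sum_(i < d) gamma_coef i1 n i ^+ 3 * beta_coef j i.

Definition berry_esseen_ratio (i1 : 'I_d) (n : nat) : R :=
  rho3 i1 n / (Num.sqrt n%:R * rho2 i1 n `^ (3 / 2)).

End increment.

Section urn.
Context (R : realType) (d : nat).

(* Row [v] of the transition matrix of the walk with increment law [p]. *)
Definition walk_row (p : 'rV[int]_d -> R) (v u : 'rV[int]_d) : R := p (u - v).

Definition initial_configuration (U0 : 'rV[int]_d -> R) : Prop :=
  (forall v, 0 <= U0 v) /\ \esum_(v in [set: 'rV[int]_d]) (U0 v)%:E = 1%E.

Context (dT : measure_display) (T : measurableType dT) (P : probability T R).

(* The sigma-algebra generated by [U 0, ..., U n]. *)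
Definition urn_history (U : nat -> T -> 'rV[int]_d -> R) (n : nat) :
    set (set T) :=
  <<s [set A | exists k v (B : set (measurableTypeR R)),
         [/\ (k <= n)%N, measurable B & A = (fun w => U k w v) @^-1` B]] >>.

(* [f] is a version of the conditional probability of [E] given [G]. *)
Definition is_cond_prob (G : set (set T)) (E : set T) (f : T -> R) : Prop :=
  (forall B : set (measurableTypeR R), measurable B -> G (f @^-1` B)) /\
  (forall A, G A -> P (A `&` E) = (\int[P]_(w in A) (f w)%:E)%E).

Record infinite_color_urn (p U0 : 'rV[int]_d -> R)
    (U : nat -> T -> 'rV[int]_d -> R) (Z : nat -> T -> 'rV[int]_d) : Prop := {
  urn_discrete : forall n, discrete_rv (Z n);
  urn_init : forall w v, U 0%N w v = U0 v;
  urn_select : forall n v,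
    is_cond_prob (urn_history U n) (Z n @^-1` [set v])
      (fun w => U n w v / n.+1%:R);
  urn_update : forall n w u, U n.+1 w u = U n w u + walk_row p (Z n w) u }.

End urn.

Definition normalized_color (R : realType) (d : nat) (mu : 'rV[R]_d)
    (Sigma : 'M[R]_d) (n : nat) (z : 'rV[int]_d) : 'rV[R]_d :=
  ((Num.sqrt (ln n%:R))^-1 *: (vec_of_int R z - ln n%:R *: mu))
    *m invmx (sqrtmx Sigma).

(* Main.v *)
Require Import Defs.
From mathcomp Require Import all_boot all_order all_algebra.
From mathcomp Require Import all_classical all_reals all_analysis.
From mathcomp Require Import measurable_realfun spectral complex ring lra.

(** Why the theorem holds.

    The rule of the urn says that the law of [Z (n + 1)] is a mixture: with
    probability [1 - 1 / (n + 2)] the law of [Z n], and otherwise the law of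
    [Z n] plus an independent increment. Hence [Z n] is distributed as a colour
    drawn from [U0], moved by a lazy walk whose [j]-th step is an increment with
    probability [1 / (j + 1)] and null otherwise ([urn_law]). The increments take
    finitely many values [B u], with probabilities [p u], and the colour is an
    affine function of the numbers of occurrences of these values
    ([walk_avg_counts]). A Berry-Esseen bound of order [1 / sqrt (ln n)] for the
    colour follows from a Gaussian approximation of these counts, each of which is
    nearly Poisson with mean [p u * ln n], nearly independently of the others.

    This is made precise by Stein's method. A size-bias identity holds up to a
    bounded error: weighting an expectation by the count of [u] amounts to adding
    one increment [u] and multiplying by [p u * w], where
    [w = 1 / 2 + ... + 1 / (n + 1)] differs from [ln n] by at most [1]
    ([count_size_bias], [walk_intensity_ln]). The finite difference that appears is
    compared with the derivative in Stein's equation by averaging this equation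
    over one lattice step, and the solution is bounded and Lipschitz for every
    test function between [0] and [1] ([stein_smooth]). So one count, smoothed
    over a lattice step, can be exchanged for a normal variable at the cost of
    [C / sqrt (p u * ln n)], with [C] independent of the test function
    ([stein_swap]). The coordinates are exchanged one after the other
    ([stein_swaps]).

    When all counts are normal, the standardised colour is a Gaussian average
    along vectors whose Gram matrix is the identity. Rotations of the plane leave
    Gaussian averages invariant ([gauss_mean_rot]) and reduce this family to the
    canonical basis, so the average of a product of functions of the
    coordinates is the product of their one-dimensional Gaussian means
    ([gauss_avg_prod]). Applied to products of ramps lying above and below the
    indicator of an orthant, at a distance of the order of the lattice spacing,
    this gives the bound for the distribution function, since the normal
    distribution function is Lipschitz ([walk_cdf]).

    Finally the ratio in the theorem lies between two positive multiples of
    [1 / sqrt (ln n)] ([berry_esseen_ratio_bounds]): the matrices [Sigma - t *: M]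
    are positive definite for [t] up to [1 / 2], so their determinants and
    principal minors stay between positive constants, and the third moments do
    likewise. The upper bound is the second claim; the lower bound turns a rate of
    [1 / sqrt (ln n)] into the first claim. *)

Set Implicit Arguments.
Unset Strict Implicit.
Unset Printing Implicit Defensive.

Import Order.TTheory GRing.Theory Num.Theory.
Import numFieldNormedType.Exports.

Local Open Scope classical_set_scope.
Local Open Scope ring_scope.

(** * Averages against a probability density *)

Section density.
Context {R : realType}.
Local Notation mu := (@lebesgue_measure R).
Implicit Types w h : R -> R.

(** Two weights serve as [w]: the standard normal density, and the indicator of
    [[0, 1]], which averages over a unit step. *)
Record density w : Prop := Density {
  density_ge0 : forall x, 0 <= w x;
  density_int : mu.-integrable setT (EFin \o w);
  density_1 : (\int[mu]_x (w x)%:E = 1)%E }.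

Definition bounded_mfun h : Prop :=
  measurable_fun setT h /\ exists M, forall x, `|h x| <= M.

Definition mean w h : R := \int[mu]_s (h s * w s).

Lemma bounded_mfunD h1 h2 : bounded_mfun h1 -> bounded_mfun h2 ->
  bounded_mfun (fun x => h1 x + h2 x).
Proof.
move=> [m1 [M1 b1]] [m2 [M2 b2]]; split; first exact: measurable_funD.
by exists (M1 + M2) => x; rewrite (le_trans (ler_normD _ _))// lerD.
Qed.

Lemma bounded_mfun_cst c : bounded_mfun (cst c).
Proof. by split => //; exists `|c|. Qed.

Lemma bounded_mfunZ a h : bounded_mfun h -> bounded_mfun (fun x => a * h x).
Proof.
move=> [mh [M bh]]; split; first exact: measurable_funM.
by exists (`|a| * M) => x; rewrite normrM ler_wpM2l.
Qed.

Lemma bounded_mfun_sum (I : Type) (r : seq I) (F : I -> R -> R) :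
  (forall i, bounded_mfun (F i)) -> bounded_mfun (fun x => \sum_(i <- r) F i x).
Proof.
move=> bF; elim: r => [|i r IH].
  by under eq_fun do rewrite big_nil; exact: bounded_mfun_cst.
by under eq_fun do rewrite big_cons; exact: bounded_mfunD.
Qed.

Lemma bounded_mfun_itv h : continuous h -> (forall x, 0 <= h x <= 1) ->
  bounded_mfun h.
Proof.
move=> ch h01; split; first exact: continuous_measurable_fun.
by exists 1 => x; have /andP[h0 h1] := h01 x; rewrite ger0_norm.
Qed.

Variable w : R -> R.
Hypothesis dw : density w.

Lemma density_integrable h : bounded_mfun h ->
  mu.-integrable setT (EFin \o (fun s => h s * w s)).
Proof.
move=> [mh [M hM]].
have mw : measurable_fun setT w.
  by have /integrableP[/measurable_EFinP] := density_int dw.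
apply: (@le_integrable _ _ _ mu setT measurableT _
  (EFin \o (fun s => M * w s))).
- by apply/measurable_EFinP; exact: measurable_funM.
- move=> x _ /=; rewrite lee_fin !normrM ler_wpM2r//.
  exact: le_trans (hM x) (ler_norm _).
- rewrite (_ : _ \o _ = (fun s => M%:E * (w s)%:E)%E); last first.
    by apply/funext => s /=; rewrite EFinM.
  by apply: integrableZl => //; exact: density_int.
Qed.

Lemma mean_cst c : mean w (cst c) = c.
Proof.
rewrite /mean RintegralZl//; last exact: density_int.
by rewrite /Rintegral density_1//= mulr1.
Qed.

Lemma mean_ext h1 h2 : h1 =1 h2 -> mean w h1 = mean w h2.
Proof. by move=> /funext ->. Qed.

Lemma mean_le h1 h2 : bounded_mfun h1 -> bounded_mfun h2 ->
  (forall x, h1 x <= h2 x) -> mean w h1 <= mean w h2.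
Proof.
move=> b1 b2 le12; apply: le_Rintegral => //.
- exact: density_integrable.
- exact: density_integrable.
- by move=> x _; rewrite ler_wpM2r// density_ge0.
Qed.

Lemma meanD h1 h2 : bounded_mfun h1 -> bounded_mfun h2 ->
  mean w (fun x => h1 x + h2 x) = mean w h1 + mean w h2.
Proof.
move=> b1 b2; rewrite /mean -RintegralD//; try exact: density_integrable.
by apply: eq_Rintegral => x _; rewrite mulrDl.
Qed.

Lemma meanZ a h : bounded_mfun h -> mean w (fun x => a * h x) = a * mean w h.
Proof.
move=> bh; rewrite /mean -RintegralZl//; last exact: density_integrable.
by apply: eq_Rintegral => x _; rewrite mulrA.
Qed.

Lemma meanB h1 h2 : bounded_mfun h1 -> bounded_mfun h2 ->
  mean w (fun x => h1 x - h2 x) = mean w h1 - mean w h2.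
Proof.
move=> b1 b2; rewrite -[in RHS]mulN1r -meanZ// -meanD//; last exact: bounded_mfunZ.
by apply: mean_ext => x; rewrite mulN1r.
Qed.

Lemma mean_sum (I : Type) (r : seq I) (F : I -> R -> R) :
  (forall i, bounded_mfun (F i)) ->
  mean w (fun x => \sum_(i <- r) F i x) = \sum_(i <- r) mean w (F i).
Proof.
move=> bF; elim: r => [|i r IH].
  rewrite big_nil -[RHS](mean_cst 0).
  by apply: mean_ext => x; rewrite big_nil.
rewrite big_cons -IH -meanD//; last exact: bounded_mfun_sum.
by apply: mean_ext => x; rewrite big_cons.
Qed.

Lemma mean_itv h : bounded_mfun h -> (forall x, 0 <= h x <= 1) ->
  0 <= mean w h <= 1.
Proof.
move=> bh h01; rewrite -[X in X <= _ <= _](mean_cst 0) -[X in _ <= _ <= X]mean_cst.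
by rewrite !mean_le//; try exact: bounded_mfun_cst; move=> x; case/andP: (h01 x).
Qed.

Lemma mean_norm_le h e : bounded_mfun h -> (forall x, `|h x| <= e) ->
  `|mean w h| <= e.
Proof.
move=> bh he; have e0 : 0 <= e by apply: le_trans (he 0).
rewrite ler_norml -[- e]mean_cst -[X in _ <= _ <= X]mean_cst.
by rewrite !mean_le//; try exact: bounded_mfun_cst;
  move=> x; have := he x; rewrite ler_norml => /andP[].
Qed.

Lemma mean_dist h1 h2 e : bounded_mfun h1 -> bounded_mfun h2 ->
  (forall x, `|h1 x - h2 x| <= e) -> `|mean w h1 - mean w h2| <= e.
Proof.
move=> b1 b2 d12; rewrite -meanB//; apply: mean_norm_le => //.
by under eq_fun do rewrite -mulN1r; apply: bounded_mfunD => //; exact: bounded_mfunZ.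
Qed.

End density.

(** * The standard normal law *)

Section gauss.
Context {R : realType}.
Local Notation mu := (@lebesgue_measure R).
Local Notation phi := (@normal_pdf R 0 1).
Implicit Types h : R -> R.

Lemma phiE x : phi x = normal_peak 1 * expR (- (x ^+ 2 / 2)).
Proof.
rewrite (normal_pdfE _ (oner_neq0 R)) /normal_fun; congr (_ * expR _).
by rewrite subr0 expr1n mulNr mulr2n.
Qed.

Lemma phi_gt0 x : 0 < phi x.
Proof. by rewrite phiE mulr_gt0 ?expR_gt0// normal_peak_gt0// oner_neq0. Qed.

Lemma phi_continuous : continuous phi.
Proof. by apply: continuous_normal_pdf; exact: oner_neq0. Qed.

Lemma density_phi : density phi.
Proof.
split; first by move=> x; exact: normal_pdf_ge0.
- exact: integrable_normal_pdf.
- exact: integral_normal_pdf.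
Qed.

Lemma density_unit : density (\1_`[0, 1] : R -> R).
Proof.
have m01 : measurable (`[0%R, 1%R] : set R) by [].
split; first by move=> x; rewrite indicE.
- exact: integrable_indic_itv.
- by rewrite integral_indic//= setIT lebesgue_measure_itv/= lte01 oppr0 adde0.
Qed.

Definition gauss_mean h : R := mean phi h.
Definition unit_mean h : R := mean \1_`[0, 1] h.

Lemma continuous_measurable_EFin (f : R -> R) (D : set R) :
  continuous f -> measurable_fun D (fun x => (f x)%:E).
Proof.
move=> cf; have : measurable_fun D (EFin \o f) by [
  apply/measurable_EFinP; apply: measurable_funTS;
  exact: continuous_measurable_fun].
exact.
Qed.

Lemma ge0_integral_oppr (G : R -> R) : continuous G -> (forall x, 0 <= G x) ->
  (\int[mu]_x (G x)%:E = \int[mu]_x (G (- x))%:E)%E.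
Proof.
move=> cG G0.
have cGN : continuous (fun x => G (- x)).
  by move=> x; apply: continuous_comp; [exact: oppr_continuous|exact: cG].
have mE (g : R -> R) (D : set R) : continuous g -> measurable_fun D (EFin \o g).
  exact: continuous_measurable_EFin.
have split0 (g : R -> R) : continuous g -> (forall x, 0 <= g x) ->
    (\int[mu]_x (g x)%:E =
     \int[mu]_(x in `]-oo, 0%R]) (g x)%:E +
     \int[mu]_(x in `[0%R, +oo[) (g x)%:E)%E.
  move=> cg g0; rewrite -integral_itv_obnd_cbnd; last exact: mE.
  rewrite -ge0_integral_setU //=.
  - by rewrite -setCitvl setUv.
  - by rewrite -setCitvl setUv; exact: mE.
  - by move=> x _; rewrite lee_fin.
  - by rewrite -setCitvl; apply/disj_setPCl.
rewrite (split0 _ cG G0) (split0 _ cGN)// addeC; congr (_ + _)%E.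
- have := @ge0_integration_by_substitutionNy R (fun x => G (- x)) 0.
  rewrite oppr0 => ->//; last exact: continuous_subspaceT.
  by apply: eq_integral => x _ /=; rewrite opprK.
- have := @ge0_integration_by_substitutionNy R G 0.
  by rewrite oppr0 => ->//; exact: continuous_subspaceT.
Qed.

Lemma ge0_integral_affine (G : R -> R) (a b : R) : 0 < a -> continuous G ->
  (forall x, 0 <= G x) ->
  (\int[mu]_x (G x)%:E = \int[mu]_x (G (a * x + b) * a)%:E)%E.
Proof.
move=> a0 cG G0; pose F (x : R) := a * x + b.
have dF (x : R) : is_derive (x : R^o) 1 (F : R^o -> R^o) a.
  rewrite /F; apply: is_derive_eq; rewrite addr0.
  by rewrite /GRing.scale/= mulr1.
have F'E : F^`()%classic = cst a by apply/funext => x; rewrite derive1E; apply: derive_val.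
rewrite (@increasing_ge0_integration_by_substitutionT R F)//; rewrite ?F'E//.
- by move=> x y xy; rewrite /F ltrD2r ltr_pM2l.
- by move=> x; exact: cvg_cst.
- exact: is_cvg_cst.
- exact: is_cvg_cst.
- apply: (@cvg_comp _ _ _ (fun x => a * x) (fun x => x + b)); last exact: cvg_addrr_Ny.
  exact/gt0_cvgMrNy.
- apply: (@cvg_comp _ _ _ (fun x => a * x) (fun x => x + b)); last exact: cvg_addrr.
  exact/gt0_cvgMry.
Qed.

Lemma gauss_meanN h : continuous h -> (forall x, 0 <= h x) ->
  gauss_mean (fun s => h (- s)) = gauss_mean h.
Proof.
move=> ch h0; have phiN s : phi (- s) = phi s by rewrite !phiE sqrrN.
rewrite /gauss_mean /mean /Rintegral [in RHS]ge0_integral_oppr.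
- by congr fine; apply: eq_integral => x _; rewrite phiN.
- by move=> x; apply: cvgM; [exact: ch|exact: phi_continuous].
- by move=> x; rewrite mulr_ge0// normal_pdf_ge0.
Qed.

End gauss.

(** * Stein's equation for the normal law *)

Section stein.
Context {R : realType}.
Local Notation mu := (@lebesgue_measure R).
Local Notation phi := (@normal_pdf R 0 1).

Lemma is_derive_phi (x : R) : is_derive (x : R^o) 1 (phi : R^o -> R^o) (- x * phi x).
Proof.
rewrite (_ : phi = fun x => normal_peak 1 * expR (- (x ^+ 2 / 2))); last first.
  by apply/funext => y; exact: phiE.
have d2 : is_derive (x : R^o) 1 (fun y : R^o => - (y ^+ 2 / 2) : R^o) (- x).
  by apply: is_derive_eq; rewrite /GRing.scale/=; field.
have de := @is_derive1_comp R expR (fun y : R => - (y ^+ 2 / 2)) x _ _ (is_derive_expR _) d2.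
have -> : (fun y : R => normal_peak 1 * expR (- (y ^+ 2 / 2))) =
    normal_peak 1 *: (expR \o (fun y : R => - (y ^+ 2 / 2))) by [].
by apply: is_derive_eq; rewrite /GRing.scale/=; ring.
Qed.

Lemma cvg_phi_pinfty : phi x @[x --> +oo] --> 0.
Proof.
rewrite (_ : phi = fun x => normal_peak 1 * gauss_fun (x / Num.sqrt 2)); last first.
  apply/funext => y; rewrite phiE /gauss_fun; congr (_ * expR (- _)).
  by rewrite exprMn exprVn sqr_sqrtr.
rewrite -[0](mulr0 (normal_peak 1)); apply: cvgM; first exact: cvg_cst.
apply: (@cvg_comp _ _ _ (fun x => x / Num.sqrt 2) gauss_fun); last exact: cvg_gauss_fun.
by apply: gt0_cvgMly; [rewrite invr_gt0 sqrtr_gt0|exact: cvg_id].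
Qed.

Definition gauss_tail (x : R) : R := \int[mu]_(t in `[x, +oo[) phi t.

Lemma integrable_phi (D : set R) : measurable D -> mu.-integrable D (EFin \o phi).
Proof.
by move=> mD; apply: integrableS (@integrable_normal_pdf R 0 1).
Qed.

Lemma gauss_tailE x : (gauss_tail x)%:E = (\int[mu]_(t in `[x, +oo[) (phi t)%:E)%E.
Proof.
rewrite /gauss_tail /Rintegral fineK//.
by apply: integrable_fin_num => //; exact: integrable_phi.
Qed.

(** Mills' bound: on the half-line [t >= x] the weight [x] is at most [t], and
    [t * phi t] integrates exactly. *)
Lemma gauss_tail_mills x : 0 <= x -> x * gauss_tail x <= phi x.
Proof.
move=> x0; rewrite -lee_fin EFinM gauss_tailE -ge0_integralZl//=; last 2 first.
- exact: (continuous_measurable_EFin (f := phi)) phi_continuous.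
- by move=> t _; rewrite lee_fin ltW// phi_gt0.
have cf : continuous (fun t : R => t * phi t).
  by move=> t; apply: cvgM; [exact: cvg_id|exact: phi_continuous].
have dN t : is_derive (t : R^o) 1 (fun t : R^o => - phi t : R^o) (t * phi t).
  by have := is_derive_phi t => ?; apply: is_derive_eq; rewrite mulNr opprK.
have := @ge0_continuous_FTC2y R (fun t => t * phi t) (fun t => - phi t) x 0.
rewrite sub0e -EFinN opprK => <-.
- apply: ge0_le_integral => //=.
  + by move=> t _; rewrite lee_fin mulr_ge0// ltW// phi_gt0.
  + apply: (continuous_measurable_EFin (f := fun t => x * phi t)).
    by move=> t; apply: cvgM; [exact: cvg_cst|exact: phi_continuous].
  + exact: (continuous_measurable_EFin (f := fun t => t * phi t)).
  + move=> t; rewrite in_itv/= andbT => xt.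
    by rewrite lee_fin ler_wpM2r// ltW// phi_gt0.
- by move=> t xt; rewrite mulr_ge0// ?(le_trans x0 xt)// ltW// phi_gt0.
- exact: continuous_subspaceT.
- by rewrite -[X in _ --> X]oppr0; apply: (@cvgN _ R^o); exact: cvg_phi_pinfty.
- by move=> t _; have := dN t => -[].
- by apply: cvg_at_right_filter; apply: cvgN; exact: phi_continuous.
- by move=> t _; rewrite derive1E; exact: derive_val.
Qed.

Lemma gauss_lower_tail x : \int[mu]_(t in `]-oo, x]) phi t = gauss_tail (- x).
Proof.
rewrite /gauss_tail /Rintegral -[x in LHS]opprK ge0_integration_by_substitutionNy.
- congr fine; apply: eq_integral => t _ /=.
  by rewrite !phiE sqrrN.
- by apply: continuous_subspaceT; exact: phi_continuous.
- by move=> t _; rewrite ltW// phi_gt0.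
Qed.

Lemma gauss_tail_le1 x : 0 <= gauss_tail x <= 1.
Proof.
rewrite /gauss_tail Rintegral_ge0/=; last by move=> t _; rewrite ltW// phi_gt0.
rewrite -lee_fin gauss_tailE -(@integral_normal_pdf R 0 1).
apply: ge0_subset_integral => //.
- by apply/measurable_EFinP; exact: measurable_normal_pdf.
- by move=> t _; rewrite lee_fin ltW// phi_gt0.
Qed.

(** The solution is [F / phi], with [F] the primitive of [(h - E h) * phi] from
    minus infinity. As [F] also vanishes at plus infinity, [|F x|] is at most the
    Gaussian mass beyond [|x|], so that Mills' bound controls [x * f x], and
    hence [f] away from the origin. *)
Lemma stein_solution : exists2 C : R, 0 < C & forall h : R -> R, continuous h ->
  (forall x, 0 <= h x <= 1) ->
  exists f : R -> R, [/\ forall x, `|f x| <= C, forall x, `|x * f x| <= 1 &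
    forall x, is_derive (x : R^o) 1 (f : R^o -> R^o)
      (x * f x + (h x - gauss_mean h))].
Proof.
exists (1 + (phi 1)^-1).
  by rewrite ltr_pwDr ?ler01// invr_gt0 phi_gt0.
move=> h ch h01; set c := gauss_mean h.
have bh : bounded_mfun h by exact: bounded_mfun_itv.
have c01 : 0 <= c <= 1 by apply: mean_itv => //; exact: density_phi.
have kb x : `|h x - c| <= 1.
  by have := h01 x; move: c01; rewrite ler_norml; lra.
pose w x := (h x - c) * phi x.
have cw : continuous w.
  move=> x; apply: cvgM; last exact: phi_continuous.
  by apply: cvgB; [exact: ch|exact: cvg_cst].
have iw : mu.-integrable setT (EFin \o w).
  apply: (density_integrable density_phi).
  by apply: bounded_mfunD => //; exact: bounded_mfun_cst.
have iwD (D : set R) : measurable D -> mu.-integrable D (EFin \o w).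
  by move=> mD; apply: integrableS iw.
have w_le (D : set R) : measurable D ->
    `|\int[mu]_(t in D) w t| <= \int[mu]_(t in D) phi t.
  move=> mD; apply: (le_trans (le_normr_Rintegral _ _)) => //; first exact: iwD.
  apply: le_Rintegral => //; [|exact: integrable_phi|].
  - exact: (integrable_norm (iwD _ mD)).
  - move=> x _; rewrite normrM (ger0_norm (ltW (phi_gt0 x))) ler_piMl//.
    by rewrite ltW// phi_gt0.
(* The two formulas for [F] give the bound on either side of the origin. *)
pose F x := \int[mu]_(t in `]-oo, x]) w t.
have F_tail x : F x = - \int[mu]_(t in `[x, +oo[) w t.
  apply/eqP; rewrite -addr_eq0 -Rintegral_itv_obnd_cbnd; last exact: iwD.
  rewrite /F -Rintegral_setU//=.
  - rewrite -setCitvl setUv /w.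
    under eq_Rintegral do rewrite mulrBl.
    rewrite RintegralB//.
    + rewrite -/(mean phi h) -/(mean phi (cst c)) (mean_cst density_phi).
      by rewrite subrr.
    + exact: (density_integrable density_phi).
    + exact: (density_integrable density_phi (bounded_mfun_cst c)).
  - by rewrite -setCitvl setUv.
  - by rewrite -setCitvl; apply/disj_setPCl.
have bF x : `|F x| <= gauss_tail `|x|.
  have [x0|x0] := ger0P x.
  - by rewrite F_tail normrN; exact: w_le.
  - by rewrite -gauss_lower_tail; exact: w_le.
have bxF x : `|x * F x| <= phi x.
  rewrite normrM (le_trans (ler_wpM2l _ (bF x)))//.
  rewrite (le_trans (gauss_tail_mills _))// !phiE.
  by rewrite -normrX ger0_norm// sqr_ge0.
have dF (x : R) : is_derive (x : R^o) 1 (F : R^o -> R^o) (w x).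
  have xx1 : x < x + 1 by rewrite ltrDl.
  have iwx : mu.-integrable [set` Interval -oo%O (BRight (x + 1))] (EFin \o w).
    exact: iwD.
  have [dF F'] := continuous_FTC1 xx1 iwx (ltNyr _) (cw x).
  by apply: DeriveDef => //; rewrite -derive1E.
exists (fun x => F x / phi x); split => [x|x|x].
- rewrite normrM normfV (ger0_norm (ltW (phi_gt0 x))) ler_pdivrMr ?phi_gt0//.
  have [x1|x1] := lerP `|x| 1.
  + apply: (@le_trans _ _ 1).
      by rewrite (le_trans (bF x))//; case/andP: (gauss_tail_le1 `|x|).
    rewrite mulrDl mul1r -[leLHS]add0r lerD ?(ltW (phi_gt0 _))//.
    rewrite mulrC ler_pdivlMr ?phi_gt0// mul1r !phiE ler_wpM2l ?normal_peak_ge0//.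
    rewrite ler_expR lerN2 ler_pM2r ?invr_gt0// expr1n.
    by rewrite -(ger0_norm (sqr_ge0 x)) normrX expr_le1.
  + have : `|F x| <= phi x.
      apply: le_trans (bxF x); rewrite normrM ler_peMl//; exact: ltW.
    move/le_trans; apply; rewrite mulrDl mul1r lerDl mulr_ge0// ?invr_ge0 ltW//;
      exact: phi_gt0.
- rewrite mulrA normrM normfV (ger0_norm (ltW (phi_gt0 x))).
  by rewrite ler_pdivrMr ?phi_gt0// mul1r.
- have := dF x; have := is_derive_phi x => dphi dFx.
  have phi0 : phi x != 0 by rewrite gt_eqF// phi_gt0.
  apply: is_derive_eq.
  rewrite /GRing.scale/= /w; field.
  exact: phi0.
Qed.

End stein.

Section stein_smooth.
Context {R : realType}.
Local Notation mu := (@lebesgue_measure R).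

Lemma unit_meanE (h : R -> R) : unit_mean h = \int[mu]_(t in `[0, 1]) h t.
Proof.
rewrite /unit_mean /mean [RHS]Rintegral_mkcond; apply: eq_Rintegral => x _.
rewrite indicE patchE; case: ifPn => xI; first by rewrite mulr1.
by rewrite mulr0.
Qed.

Let integrable01 (f : R -> R) : continuous f -> mu.-integrable `[0, 1] (EFin \o f).
Proof.
move=> cf; apply: continuous_compact_integrable; first exact: segment_compact.
exact: continuous_subspaceT.
Qed.

Lemma unit_mean_derive (f F : R -> R) : continuous f ->
  (forall x, is_derive (x : R^o) 1 (F : R^o -> R^o) (f x)) ->
  unit_mean f = F 1 - F 0.
Proof.
move=> cf dF; rewrite unit_meanE /Rintegral (@continuous_FTC2 _ f F)//.
- exact: continuous_subspaceT.
- have cF x : {for x, continuous F}.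
    by apply: differentiable_continuous; apply/derivable1_diffP; have [] := dF x.
  split => [x _||].
  + by have [] := dF x.
  + by apply: cvg_at_right_filter; exact: cF.
  + by apply: cvg_at_left_filter; exact: cF.
- by move=> x _; rewrite derive1E; have := dF x => ?; exact: derive_val.
Qed.

Lemma unit_mean_dist_derive (h f F : R -> R) c K : continuous h -> continuous f ->
  (forall x, is_derive (x : R^o) 1 (F : R^o -> R^o) (f x)) ->
  (forall t, 0 <= t <= 1 -> `|h t - c - f t| <= K) ->
  `|unit_mean h - c - (F 1 - F 0)| <= K.
Proof.
move=> ch cf dF hK; rewrite -(unit_mean_derive cf dF).
have c1 : c = \int[mu]_(t in `[0, 1]) c.
  by rewrite Rintegral_cst//= lebesgue_measure_itv/= lte01 oppr0 adde0 mulr1.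
have K1 : K = \int[mu]_(t in `[0, 1]) K.
  by rewrite Rintegral_cst//= lebesgue_measure_itv/= lte01 oppr0 adde0 mulr1.
have ccst (k : R) : continuous (fun _ : R => k) by move=> x; exact: cvg_cst.
have chc : continuous (fun t => h t - c).
  by move=> x; apply: cvgB; [exact: ch|exact: cvg_cst].
have chcf : continuous (fun t => h t - c - f t).
  by move=> x; apply: cvgB; [exact: chc|exact: cf].
rewrite !unit_meanE [in X in `|X|]c1 -RintegralB//; try exact: integrable01.
rewrite -RintegralB//; try exact: integrable01.
rewrite [leRHS]K1; apply: le_trans (le_normr_Rintegral _ _) _ => //.
  exact: integrable01.
apply: le_Rintegral => //.
- by apply: integrable01 => x; apply: cvg_norm; exact: chcf.
- exact: integrable01.
Qed.

(** Integrating Stein's equation over [[xi, xi + 1 / s]] turns [f'] into a finite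
    difference. Over this interval the term [x * f x] varies by at most
    [(2 * |xi| + C) / s], because the equation makes [f] Lipschitz with constant
    [2]; no regularity of [h] enters the bound. *)
Lemma stein_smooth : exists2 C : R, 0 < C & forall h : R -> R, continuous h ->
  (forall x, 0 <= h x <= 1) ->
  exists f : R -> R, [/\ forall x, `|f x| <= C,
    continuous f &
    forall s xi, 0 < s ->
      `|unit_mean (fun t => h (xi + t / s)) - gauss_mean h
        - (s * (f (xi + s^-1) - f xi) - xi * f xi)| <= (2 * `|xi| + C) / s].
Proof.
have [C C0 stein] := @stein_solution R.
exists C => // h ch h01; have [f [fC xfC df]] := stein h ch h01.
have cf x : {for x, continuous f}.
  by apply: differentiable_continuous; apply/derivable1_diffP; have [] := df x.
have g01 : 0 <= gauss_mean h <= 1.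
  by apply: mean_itv => //; [exact: density_phi|exact: bounded_mfun_itv].
have flip x y : `|f x - f y| <= 2 * `|x - y|.
  wlog xy : x y / x <= y.
    by move=> H; have [/H//|/ltW/H] := leP x y; rewrite distrC (distrC y).
  have := @MVT_segment R f _ x y xy => /(_ _ (fun z _ => df z)) [].
    exact: continuous_subspaceT.
  move=> z _ fE; rewrite distrC fE normrM (distrC x) ler_wpM2r//.
  rewrite (le_trans (ler_normD _ _))//.
  have : `|h z - gauss_mean h| <= 1.
    by have := h01 z; have := g01; rewrite ler_norml; lra.
  by have := xfC z; lra.
exists f; split => // s xi s0.
(* A primitive of the integrand: the equation has been used to rewrite [f']. *)
pose F t := s * f (xi + t / s) - (xi * f xi) * t.
have cshift : continuous (fun t : R => xi + t / s).
  move=> t; apply: cvgD; first exact: cvg_cst.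
  by apply: cvgM; [exact: cvg_id|exact: cvg_cst].
have dF (t : R) : is_derive (t : R^o) 1 (F : R^o -> R^o)
    ((xi + t / s) * f (xi + t / s) + (h (xi + t / s) - gauss_mean h) - xi * f xi).
  have dl : is_derive (t : R^o) 1 (fun t : R^o => xi + t / s : R^o) s^-1.
    by apply: is_derive_eq; rewrite /GRing.scale/=; ring.
  have dc := @is_derive1_comp R f (fun t : R => xi + t / s) t _ _ (df _) dl.
  have -> : F = s *: (f \o (fun t : R => xi + t / s)) - (xi * f xi) *: id by [].
  apply: is_derive_eq; rewrite /GRing.scale/=; field.
  exact: lt0r_neq0.
have := @unit_mean_dist_derive (fun t => h (xi + t / s)) _ F (gauss_mean h)
  ((2 * `|xi| + C) / s) _ _ dF.
rewrite /F !mul0r addr0 mulr0 subr0 mulr1 mul1r => H.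
rewrite (_ : s * _ - _ = s * f (xi + s^-1) - xi * f xi - s * f xi); last by ring.
apply: H.
- by move=> t; apply: continuous_comp; [exact: cshift|exact: ch].
- move=> t; apply: cvgB; last exact: cvg_cst.
  apply: cvgD.
    apply: cvgM; first exact: cshift.
    by apply: continuous_comp; [exact: cshift|exact: cf].
  apply: cvgB; last exact: cvg_cst.
  by apply: continuous_comp; [exact: cshift|exact: ch].
- move=> t /andP[t0 t1].
  rewrite (_ : _ - _ - _ = - (xi * (f (xi + t / s) - f xi) + t / s * f (xi + t / s))); last by ring.
  rewrite normrN (le_trans (ler_normD _ _))// !normrM.
  have ts : `|t / s| <= s^-1.
    by rewrite normrM (ger0_norm t0) normfV (gtr0_norm s0) ler_piMl// invr_ge0 ltW.
  have := flip (xi + t / s) xi; rewrite [in X in _ <= X](addrC xi) addrK => ff.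
  rewrite mulrDl lerD//.
    rewrite (mulrC 2) -mulrA ler_wpM2l// (le_trans ff)// ler_wpM2l//.
  by rewrite mulrC ler_pM// -normrM.
Qed.

End stein_smooth.

(** * Rotation invariance of the plane Gaussian *)

Section rotation.
Context {R : realType}.
Local Notation mu := (@lebesgue_measure R).
Local Notation phi := (@normal_pdf R 0 1).

(** The Lipschitz constant only has to exist, here and in the similar predicates
    below: it makes averages measurable, and no error bound depends on it. *)
Definition lip2 (Psi : R -> R -> R) : Prop :=
  (forall s t, 0 <= Psi s t <= 1) /\
  exists2 L, 0 <= L & forall s t s' t',
    `|Psi s t - Psi s' t'| <= L * (`|s - s'| + `|t - t'|).

Lemma lip_continuous (h : R -> R) L :
  (forall s t, `|h s - h t| <= L * `|s - t|) -> continuous h.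
Proof.
move=> hL x; apply/cvgrPdist_le => e e0.
near=> y; rewrite (le_trans (hL x y))//.
have L0 : 0 <= `|L| by [].
apply: (@le_trans _ _ ((`|L| + 1) * `|x - y|)).
  by rewrite ler_wpM2r// ler_wpDr// ler_norm.
rewrite -ler_pdivlMl ?ltr_pwDr//.
by near: y; apply: cvgr_dist_le => //; rewrite mulr_gt0// invr_gt0 ltr_pwDr.
Unshelve. all: by end_near. Qed.

(** A function that is Lipschitz in its first argument, uniformly in the
    second, is the supremum over rational [q] of [Psi q t - L * |s - q|], and each
    of these is measurable in the pair. *)
Lemma measurable_fun_lip_l (Psi : R -> R -> R) L : 0 <= L ->
  (forall s s' t, `|Psi s t - Psi s' t| <= L * `|s - s'|) ->
  (forall s, measurable_fun setT (Psi s)) ->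
  measurable_fun setT (fun z : R * R => Psi z.1 z.2).
Proof.
move=> L0 lipL mPsi.
move=> mT; apply: (measurability _ (RGenOInfty.measurableE R)) => //.
move=> _ [_ [a ->] <-]; rewrite setTI.
rewrite (_ : _ @^-1` _ = \bigcup_q
  ((fun z : R * R => Psi (ratr q) z.2 - L * `|z.1 - ratr q|) @^-1` `]a, +oo[)).
  apply: bigcupT_measurable_rat => q; rewrite -[X in measurable X]setTI.
  apply: measurable_funB => //.
  - by apply: (measurableT_comp (mPsi (ratr q))); exact: measurable_snd.
  - apply: measurable_funM => //; apply: (measurableT_comp (@normr_measurable R setT)).
    by apply: measurable_funB => //; exact: measurable_fst.
apply/seteqP; split => [[s t]|[s t] [q _]] /=; rewrite !in_itv/= !andbT.
- move=> aP; pose e := (Psi s t - a) / (L + L + 1).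
  have e0 : 0 < e by rewrite divr_gt0 ?subr_gt0// ltr_pwDr// addr_ge0.
  have sse : s < s + e by rewrite ltrDl.
  have [q qs] := rat_in_itvoo sse.
  move: qs; rewrite in_itv/= => /andP[sq qse].
  exists q => //=; rewrite in_itv/= andbT.
  have := lipL s (ratr q) t; have -> : `|s - ratr q| = ratr q - s.
    by rewrite distrC gtr0_norm// subr_gt0.
  rewrite ler_norml => /andP[_ h1].
  have he : (L + L + 1) * e = Psi s t - a by rewrite /e mulrC divfK// gt_eqF// ltr_pwDr// addr_ge0.
  have : L * (ratr q - s) <= L * e by rewrite ler_wpM2l// lerBlDl ltW.
  by lra.
- move=> aP; apply: (lt_le_trans aP); have := lipL (ratr q) s t.
  rewrite distrC (distrC (ratr q)) ler_norml => /andP[h _]; lra.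
Qed.

Lemma lip2_continuous_line Psi (a b c d : R) : lip2 Psi ->
  continuous (fun t : R => Psi (a * t + b) (c * t + d)).
Proof.
move=> [_ [L L0 PL]]; apply: (@lip_continuous _ (L * (`|a| + `|c|))) => s t.
apply: (le_trans (PL _ _ _ _)); rewrite -mulrA ler_wpM2l// mulrDl.
by rewrite -!normrM lerD// mulrBr opprD addrACA subrr addr0.
Qed.

Lemma lip2_affine Psi (a b c d : R) : lip2 Psi ->
  lip2 (fun s t => Psi (a * s + b * t) (c * s + d * t)).
Proof.
move=> [P01 [L L0 PL]]; split => //.
exists (L * (`|a| + `|b| + `|c| + `|d|)).
  by rewrite mulr_ge0// !addr_ge0.
move=> s t s' t'; apply: (le_trans (PL _ _ _ _)); rewrite -mulrA ler_wpM2l//.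
have tri u v x y x' y' : `|u * x + v * y - (u * x' + v * y')| <=
    `|u| * `|x - x'| + `|v| * `|y - y'| :> R.
  rewrite (_ : _ - _ = u * (x - x') + v * (y - y')); last by ring.
  by rewrite -!normrM ler_normD.
rewrite (le_trans (lerD (tri _ _ _ _ _ _) (tri _ _ _ _ _ _)))//.
rewrite -subr_ge0 (_ : _ - _ =
  (`|b| + `|d|) * `|s - s'| + (`|a| + `|c|) * `|t - t'|); last by ring.
by rewrite addr_ge0// mulr_ge0// addr_ge0.
Qed.

Lemma lip2_bounded_l Psi s : lip2 Psi -> bounded_mfun (Psi s).
Proof.
move=> lP; apply: bounded_mfun_itv; last by case: lP.
have := @lip2_continuous_line Psi 0 s 1 0 lP.
by under eq_fun do rewrite mul0r add0r mul1r addr0.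
Qed.

Lemma lip2_measurable Psi : lip2 Psi ->
  measurable_fun setT (fun z : R * R => Psi z.1 z.2).
Proof.
move=> lP; have [_ [L L0 PL]] := lP.
apply: (measurable_fun_lip_l L0) => [s s' t|s].
  by rewrite (le_trans (PL _ _ _ _))// subrr normr0 addr0.
by case: (lip2_bounded_l s lP).
Qed.

Lemma gauss_mean_lip2 Psi : lip2 Psi ->
  bounded_mfun (fun s => gauss_mean (Psi s)) /\
  (forall s, 0 <= gauss_mean (Psi s) <= 1).
Proof.
move=> lP; have [P01 [L L0 PL]] := lP.
have g01 s : 0 <= gauss_mean (Psi s) <= 1.
  by apply: mean_itv; [exact: density_phi|exact: lip2_bounded_l|].
split => //; apply: bounded_mfun_itv => //.
apply: (@lip_continuous _ L) => s s'.
apply: mean_dist; try exact: lip2_bounded_l; first exact: density_phi.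
by move=> t; rewrite (le_trans (PL _ _ _ _))// subrr normr0 addr0.
Qed.

Lemma gauss_mean2E Psi : lip2 Psi ->
  (gauss_mean (fun s => gauss_mean (Psi s)))%:E =
  (\int[mu]_s \int[mu]_t (Psi s t * (phi s * phi t))%:E)%E.
Proof.
move=> lP; have [bP _] := gauss_mean_lip2 lP.
have EE h : bounded_mfun h -> (gauss_mean h)%:E = (\int[mu]_s (h s * phi s)%:E)%E.
  move=> bh; rewrite /gauss_mean /mean /Rintegral fineK//.
  exact: integrable_fin_num (density_integrable density_phi bh).
rewrite EE//; apply: eq_integral => s _.
rewrite EFinM EE; last exact: lip2_bounded_l.
rewrite -ge0_integralZr//.
- by apply: eq_integral => t _; rewrite -EFinM; congr EFin; ring.
- have [mP _] := lip2_bounded_l s lP.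
  by apply/measurable_EFinP; apply: measurable_funM => //; exact: measurable_normal_pdf.
- move=> t _; rewrite lee_fin mulr_ge0 ?(ltW (phi_gt0 _))//.
  by have [/(_ s t)/andP[]] := lP.
- by rewrite lee_fin ltW ?phi_gt0.
Qed.

Lemma phiM_rot x y x' y' : x ^+ 2 + y ^+ 2 = x' ^+ 2 + y' ^+ 2 ->
  phi x * phi y = phi x' * phi y'.
Proof.
move=> h; rewrite !phiE; set p := normal_peak 1.
have e (u v : R) : p * expR (- (u ^+ 2 / 2)) * (p * expR (- (v ^+ 2 / 2))) =
    p * p * expR (- ((u ^+ 2 + v ^+ 2) / 2)).
  have -> : - ((u ^+ 2 + v ^+ 2) / 2) = - (u ^+ 2 / 2) + - (v ^+ 2 / 2) by field.
  by rewrite expRD; ring.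
by rewrite !e h.
Qed.

(** The rotation by [(alpha, beta)], composed with a reflection, is reached by two
    one-dimensional affine substitutions separated by an exchange of the order
    of integration; the density only depends on [s ^+ 2 + t ^+ 2]. *)
Lemma gauss_mean_rot Psi alpha beta : lip2 Psi ->
  0 < beta -> alpha ^+ 2 + beta ^+ 2 = 1 ->
  gauss_mean (fun s => gauss_mean (fun t =>
    Psi (alpha * s + beta * t) (beta * s - alpha * t))) =
  gauss_mean (fun s => gauss_mean (Psi s)).
Proof.
move=> lP b0 ab1; have bN0 : beta != 0 by rewrite gt_eqF.
have lProt : lip2 (fun s t => Psi (alpha * s + beta * t) (beta * s - alpha * t)).
  have := lip2_affine alpha beta beta (- alpha) lP.
  by under eq_fun do under eq_fun do rewrite mulNr.
apply: EFin_inj; rewrite (gauss_mean2E lProt) (gauss_mean2E lP).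
pose G s p := Psi p ((s - alpha * p) / beta) *
  (phi s * phi ((p - alpha * s) / beta)) / beta.
have lG : lip2 (fun s p => Psi p ((s - alpha * p) / beta)).
  have := lip2_affine 0 1 beta^-1 (- alpha / beta) lP.
  under eq_fun do under eq_fun do rewrite mul0r add0r mul1r.
  rewrite (_ : (fun s p => Psi p (beta^-1 * s + - alpha / beta * p)) =
    (fun s p => Psi p ((s - alpha * p) / beta)))//.
  by apply/funext => s; apply/funext => p; congr Psi; field.
have cphil (a b : R) : continuous (fun t : R => phi (a * t + b)).
  move=> t; apply: (@continuous_comp _ _ _ (fun t : R => a * t + b) phi);
    last exact: phi_continuous.
  apply: cvgD; last exact: cvg_cst.
  by apply: cvgM; [exact: cvg_cst|exact: cvg_id].
have G0 s p : 0 <= G s p.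
  rewrite /G !mulr_ge0 ?invr_ge0 ?(ltW (phi_gt0 _)) ?(ltW b0)//.
  by have [/(_ p ((s - alpha * p) / beta))/andP[]] := lP.
have cGs s : continuous (G s).
  have e : G s = (fun p => Psi (1 * p + 0) (- alpha / beta * p + s / beta) *
      (phi s * phi (beta^-1 * p + (- alpha * s) / beta)) / beta).
    apply/funext => p; rewrite /G; congr (Psi _ _ * (_ * phi _) / _); by field.
  rewrite e => p; apply: cvgM; last exact: cvg_cst.
  apply: cvgM; first exact: lip2_continuous_line.
  by apply: cvgM; [exact: cvg_cst|exact: cphil].
have cGp p : continuous (G ^~ p).
  have e : G ^~ p = (fun s => Psi (0 * s + p) (beta^-1 * s + (- alpha * p) / beta) *
      (phi (1 * s + 0) * phi (- alpha / beta * s + p / beta)) / beta).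
    apply/funext => s; rewrite /G; congr (Psi _ _ * (phi _ * phi _) / _); by field.
  rewrite e => s; apply: cvgM; last exact: cvg_cst.
  apply: cvgM; first exact: lip2_continuous_line.
  by apply: cvgM; exact: cphil.
have mphi : measurable_fun setT phi by exact: measurable_normal_pdf.
have mG : measurable_fun setT (fun z : R * R => (G z.1 z.2)%:E).
  apply/measurable_EFinP; apply: measurable_funM => //.
  apply: measurable_funM; first exact: (lip2_measurable lG).
  apply: measurable_funM; first exact: (measurableT_comp mphi measurable_fst).
  apply: (measurableT_comp mphi); apply: measurable_funM => //.
  apply: measurable_funB; first exact: measurable_snd.
  by apply: measurable_funM => //; exact: measurable_fst.
transitivity (\int[mu]_s \int[mu]_p (G s p)%:E)%E.
  apply: eq_integral => s _.
  rewrite (ge0_integral_affine (alpha * s) b0 (cGs s))//.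
  apply: eq_integral => t _; congr EFin; rewrite /G.
  rewrite divfK//; congr (Psi _ _ * (phi _ * phi _)).
  - by rewrite addrC.
  - apply: (mulIf bN0); rewrite divfK//.
    transitivity ((alpha ^+ 2 + beta ^+ 2 - alpha ^+ 2) * s - alpha * beta * t); first by ring.
    by rewrite ab1; ring.
  - by field.
have GE0 (z : R * R) : (0 <= (G z.1 z.2)%:E)%E by rewrite lee_fin.
transitivity (\int[mu]_p \int[mu]_s (G s p)%:E)%E.
  exact: (@fubini_tonelli _ _ _ _ _ mu mu _ mG GE0).
apply: eq_integral => p _.
rewrite (ge0_integral_affine (alpha * p) b0 (cGp p))//.
apply: eq_integral => q _; congr EFin; rewrite /G divfK//.
have -> : (p - alpha * (beta * q + alpha * p)) / beta = beta * p - alpha * q.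
  apply: (mulIf bN0); rewrite divfK//.
  transitivity ((alpha ^+ 2 + beta ^+ 2 - alpha ^+ 2) * p - alpha * beta * q); last by ring.
  by rewrite ab1; ring.
congr (Psi _ _ * _); first by field.
apply: phiM_rot.
transitivity ((alpha ^+ 2 + beta ^+ 2) * (p ^+ 2 + q ^+ 2)); first by ring.
by rewrite ab1 mul1r.
Qed.

End rotation.

(** * Gaussian averages along a family of vectors *)

Section gauss_avg.
Context {R : realType}.

Definition l1_norm n (x : 'rV[R]_n) : R := \sum_i `|x 0 i|.

Definition lip01 n (g : 'rV[R]_n -> R) : Prop :=
  (forall x, 0 <= g x <= 1) /\
  exists2 L, 0 <= L & forall x y, `|g x - g y| <= L * l1_norm (x - y).

Definition lip01R (h : R -> R) : Prop :=
  (forall x, 0 <= h x <= 1) /\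
  exists2 L, 0 <= L & forall x y, `|h x - h y| <= L * `|x - y|.

Lemma l1_norm_ge0 n (x : 'rV[R]_n) : 0 <= l1_norm x.
Proof. by apply: sumr_ge0. Qed.

Lemma l1_normD n (x y : 'rV[R]_n) : l1_norm (x + y) <= l1_norm x + l1_norm y.
Proof. by rewrite -big_split; apply: ler_sum => i _; rewrite mxE ler_normD. Qed.

Lemma l1_normZ n a (x : 'rV[R]_n) : l1_norm (a *: x) = `|a| * l1_norm x.
Proof. by rewrite mulr_sumr; apply: eq_bigr => i _; rewrite mxE normrM. Qed.

Lemma lip01R_bounded h : lip01R h -> bounded_mfun h.
Proof.
move=> [h01 [L _ hL]]; apply: bounded_mfun_itv => //; exact: lip_continuous hL.
Qed.

Lemma lip01R_shift h b : lip01R h -> lip01R (fun s => h (b + s)).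
Proof.
move=> [h01 [L L0 hL]]; split => //; exists L => // x y.
by rewrite (le_trans (hL _ _))// opprD addrACA subrr add0r.
Qed.

Lemma lip01_line n (g : 'rV[R]_n -> R) y w : lip01 g ->
  lip01R (fun s => g (y + s *: w)).
Proof.
move=> [g01 [L L0 gL]]; split => //; exists (L * l1_norm w).
  by rewrite mulr_ge0// l1_norm_ge0.
move=> s t; apply: (le_trans (gL _ _)).
by rewrite opprD addrACA subrr add0r -scalerBl l1_normZ mulrA mulrAC.
Qed.

Lemma lip01_plane n (g : 'rV[R]_n -> R) y w w' : lip01 g ->
  lip2 (fun s t => g (y + s *: w + t *: w')).
Proof.
move=> [g01 [L L0 gL]]; split => //; exists (L * (l1_norm w + l1_norm w')).
  by rewrite mulr_ge0// addr_ge0// l1_norm_ge0.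
move=> s t s' t'; apply: (le_trans (gL _ _)); rewrite -mulrA ler_wpM2l//.
have -> : y + s *: w + t *: w' - (y + s' *: w + t' *: w') =
    (s - s') *: w + (t - t') *: w'.
  by apply/rowP => i; rewrite !mxE; ring.
rewrite (le_trans (l1_normD _ _))// !l1_normZ -subr_ge0.
rewrite (_ : _ - _ = `|t - t'| * l1_norm w + `|s - s'| * l1_norm w'); last by ring.
by rewrite addr_ge0// mulr_ge0// l1_norm_ge0.
Qed.

Lemma lip01_mean n w (F : R -> 'rV[R]_n -> R) L : density w -> 0 <= L ->
  (forall s x, 0 <= F s x <= 1) ->
  (forall s x y, `|F s x - F s y| <= L * l1_norm (x - y)) ->
  (forall x, bounded_mfun (F ^~ x)) ->
  lip01 (fun x => mean w (F ^~ x)).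
Proof.
move=> dw L0 F01 FL bF; split; first by move=> x; exact: mean_itv.
by exists L => // x y; apply: mean_dist.
Qed.

(** Expectation of [g (y + \sum_k s_k *: w_k)] with independent standard normal
    [s_k], written as an iterated integral. *)
Fixpoint gauss_avg n (ws : seq 'rV[R]_n) (g : 'rV[R]_n -> R) (y : 'rV[R]_n) : R :=
  if ws is w :: ws' then gauss_mean (fun s => gauss_avg ws' g (y + s *: w))
  else g y.

Lemma gauss_avg_lip01 n (ws : seq 'rV[R]_n) g : lip01 g -> lip01 (gauss_avg ws g).
Proof.
move=> lg; elim: ws => //= w ws IH; have [g01 [L L0 gL]] := IH.
apply: (@lip01_mean _ _ (fun s y => gauss_avg ws g (y + s *: w)) L) => //.
- exact: density_phi.
- move=> s x y /=; apply: (le_trans (gL _ _)).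
  by rewrite opprD addrACA subrr addr0.
- by move=> x; apply: lip01R_bounded; exact: lip01_line.
Qed.

Lemma gauss_avg_rot n (ws : seq 'rV[R]_n) w w' g y (a b : R) : lip01 g ->
  0 < b -> a ^+ 2 + b ^+ 2 = 1 ->
  gauss_avg [:: a *: w + b *: w', b *: w - a *: w' & ws] g y =
  gauss_avg [:: w, w' & ws] g y.
Proof.
move=> lg b0 ab1 /=.
rewrite -(gauss_mean_rot (lip01_plane y w w' (gauss_avg_lip01 ws lg)) b0 ab1).
apply: mean_ext => s; apply: mean_ext => t; congr gauss_avg.
by apply/rowP => i; rewrite !mxE; ring.
Qed.

Definition gram n (ws : seq 'rV[R]_n) i j : R := \sum_(w <- ws) w 0 i * w 0 j.

(** Mixing two vectors of the family by an orthogonal matrix keeps the Gram matrix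
    and, by rotation invariance, the Gaussian average; suitable angles move the
    [i]-th coordinates onto one vector. *)
Lemma gauss_avg_givens n (i : 'I_n) (w : 'rV[R]_n) (ws : seq 'rV[R]_n) :
  exists (w0 : 'rV[R]_n) (ws' : seq 'rV[R]_n),
  [/\ forall w', w' \in ws' -> w' 0 i = 0,
    forall j k, gram (w0 :: ws') j k = gram (w :: ws) j k &
    forall g y, lip01 g -> gauss_avg (w0 :: ws') g y = gauss_avg (w :: ws) g y].
Proof.
elim: ws w => [|w' ws IH] w; first by exists w, [::].
have [w0 [ws' [ws'0 gramE avgE]]] := IH w'.
have gramE2 j k : gram [:: w, w0 & ws'] j k = gram [:: w, w' & ws] j k.
  by rewrite /gram big_cons [RHS]big_cons; congr (_ + _); exact: gramE.
have avgE2 g y : lip01 g ->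
    gauss_avg [:: w, w0 & ws'] g y = gauss_avg [:: w, w' & ws] g y.
  by move=> lg; apply: mean_ext => s; exact: avgE.
have [w0i|w0i] := eqVneq (w0 0 i) 0.
  exists w, (w0 :: ws'); split => // v; rewrite inE => /orP[/eqP ->//|].
  exact: ws'0.
pose r := Num.sqrt (w 0 i ^+ 2 + w0 0 i ^+ 2).
have r2 : r ^+ 2 = w 0 i ^+ 2 + w0 0 i ^+ 2.
  by rewrite sqr_sqrtr// addr_ge0// sqr_ge0.
have r0 : 0 < r.
  by rewrite sqrtr_gt0 ltr_wpDl ?sqr_ge0// exprn_even_gt0.
pose a := Num.sg (w0 0 i) * w 0 i / r; pose b := `|w0 0 i| / r.
have b0 : 0 < b by rewrite divr_gt0// normr_gt0.
have sg2 : Num.sg (w0 0 i) ^+ 2 = 1 by rewrite sqr_sg w0i.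
have ab1 : a ^+ 2 + b ^+ 2 = 1.
  rewrite /a /b !exprMn exprVn r2 sg2 mul1r -mulrDl real_normK ?num_real//.
  by rewrite divff// -r2 gt_eqF// exprn_gt0.
exists (a *: w + b *: w0), (b *: w - a *: w0 :: ws'); split.
- move=> v; rewrite inE => /orP[/eqP ->|]; last exact: ws'0.
  by rewrite !mxE /a /b normrEsg; ring.
- move=> j k; rewrite -gramE2 /gram !big_cons !mxE !addrA; congr (_ + _).
  transitivity ((a ^+ 2 + b ^+ 2) * (w 0 j * w 0 k + w0 0 j * w0 0 k)); first by ring.
  by rewrite ab1 mul1r.
- by move=> g y lg; rewrite gauss_avg_rot// avgE2.
Qed.

Lemma prod_dist (I : Type) (s : seq I) (f g : I -> R) : (forall i, 0 <= f i <= 1) ->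
  (forall i, 0 <= g i <= 1) ->
  `|\prod_(i <- s) f i - \prod_(i <- s) g i| <= \sum_(i <- s) `|f i - g i|.
Proof.
move=> f01 g01; elim: s => [|i s IH]; first by rewrite !big_nil subrr normr0.
rewrite !big_cons.
set F := \prod_(_ <- _) f _; set G := \prod_(_ <- _) g _.
rewrite (_ : _ - _ = (f i - g i) * F + g i * (F - G)); last by ring.
rewrite (le_trans (ler_normD _ _))// lerD//.
- rewrite normrM ler_piMr// ger0_norm.
    by apply: prodr_ile1 => j _; exact: f01.
  by apply: prodr_ge0 => j _; case/andP: (f01 j).
- rewrite normrM (le_trans _ IH)// ler_piMl// ger0_norm//;
    by case/andP: (g01 i).
Qed.

Lemma lip01_prod n (chi : 'I_n -> R -> R) : (forall i, lip01R (chi i)) ->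
  lip01 (fun y : 'rV[R]_n => \prod_i chi i (y 0 i)).
Proof.
move=> lchi; split.
  move=> x; apply/andP; split.
  - by apply: prodr_ge0 => i _; have [/(_ (x 0 i))/andP[]] := lchi i.
  - by apply: prodr_ile1 => i _; have [/(_ (x 0 i))] := lchi i.
have /choice[L PL] i : exists L, 0 <= L /\
    forall x y, `|chi i x - chi i y| <= L * `|x - y|.
  by have [_ [L L0 H]] := lchi i; exists L.
exists (\sum_i L i).
  by apply: sumr_ge0 => i _; case: (PL i).
move=> x y.
rewrite (le_trans (prod_dist _ _ _))//.
- by move=> i; case: (lchi i).
- by move=> i; case: (lchi i).
- rewrite mulr_suml; apply: ler_sum => i _; have [Li H] := PL i.
  rewrite (le_trans (H _ _))// ler_wpM2l// /l1_norm (bigD1 i)//= !mxE lerDl.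
  exact: sumr_ge0.
Qed.

(** Induction on the number of coordinates on which the family is isotropic.
    Once Givens rotations have left a single vector with a nonzero [i]-th
    coordinate, the Gram matrix forces it to be plus or minus the [i]-th basis
    vector, and it contributes the [i]-th factor. *)
Lemma gauss_avg_prod_rec n (chi : 'I_n -> R -> R) (I : {set 'I_n})
    (ws : seq 'rV[R]_n) y :
  (forall i, lip01R (chi i)) ->
  (forall j k, gram ws j k = ((j == k) && (j \in I))%:R) ->
  gauss_avg ws (fun y => \prod_i chi i (y 0 i)) y =
  \prod_i if i \in I then gauss_mean (fun s => chi i (y 0 i + s))
          else chi i (y 0 i).
Proof.
move=> lchi; have lp := lip01_prod lchi.
have [m] := ubnP #|I|; elim: m I ws y => // m IH I ws y Im gramE.
have [I0|[i iI]] := set_0Vmem I.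
  transitivity (\prod_i chi i (y 0 i)); last first.
    by apply: eq_bigr => i _; rewrite I0 inE.
  have ws0 w : w \in ws -> w = 0.
    move=> wws; apply/rowP => j; rewrite mxE.
    have := gramE j j; rewrite I0 inE andbF /gram => /eqP.
    rewrite psumr_eq0; last by move=> v _; rewrite -expr2 sqr_ge0.
    by move=> /allP/(_ _ wws)/=; rewrite mulf_eq0 orbb => /eqP.
  elim: ws y ws0 {gramE} => //= w ws IHws y ws0.
  rewrite -[RHS](mean_cst density_phi); apply: mean_ext => s /=.
  rewrite (ws0 w) ?mem_head// scaler0 addr0 IHws// => v vws.
  by apply: ws0; rewrite inE vws orbT.
case: ws gramE => [|w ws] gramE.
  have := gramE i i; rewrite /gram big_nil eqxx iI => /eqP.
  by rewrite eq_sym oner_eq0.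
have [w0 [ws' [ws'0 gramE' avgE]]] := gauss_avg_givens i w ws.
(* The other vectors do not contribute to row [i] of the Gram matrix. *)
have w0E j : w0 0 i * w0 0 j = (i == j)%:R.
  have := gramE i j; rewrite -gramE' iI andbT /gram big_cons big_seq big1 ?addr0//.
  by move=> v /ws'0 ->; rewrite mul0r.
have w0j j : j != i -> w0 0 j = 0.
  move=> ji; have := w0E j; rewrite eq_sym (negbTE ji) => /eqP.
  rewrite mulf_eq0 => /orP[/eqP w0i|/eqP//].
  by have := w0E i; rewrite eqxx w0i mul0r => /eqP; rewrite eq_sym oner_eq0.
have gramE'' j k : gram ws' j k = ((j == k) && (j \in I :\ i))%:R.
  have := gramE j k; rewrite -gramE' /gram big_cons -/(gram ws' j k) !inE.
  have [->|ji] := eqVneq j i.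
    by rewrite w0E iI andbT andbF => /eqP; rewrite -subr_eq0 addrAC subrr add0r => /eqP.
  by rewrite (w0j j ji) mul0r add0r.
rewrite -avgE//=.
transitivity (gauss_mean (fun s => (\prod_(j | j != i)
    if j \in I then gauss_mean (fun s => chi j (y 0 j + s)) else chi j (y 0 j)) *
    chi i (y 0 i + s * w0 0 i))).
  apply: mean_ext => s; rewrite (IH (I :\ i))//; last first.
    by move: Im; rewrite (cardsD1 i) iI.
  rewrite (bigD1 i)//= !inE eqxx/= mulrC !mxE; congr (_ * _).
  apply: eq_bigr => j ji; rewrite !inE ji/= !mxE (w0j j ji) mulr0 addr0.
  by [].
have [li [L L0 liL]] := lchi i.
have lsh (c : R) : lip01R (fun s => chi i (y 0 i + s * c)).
  split => //; exists (L * `|c|); first exact: mulr_ge0.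
  move=> u v; rewrite (le_trans (liL _ _))// opprD addrACA subrr add0r -mulrBl.
  by rewrite normrM mulrA mulrAC.
rewrite /gauss_mean meanZ; [|exact: density_phi|exact: lip01R_bounded].
rewrite [RHS](bigD1 i)//= iI mulrC; congr (_ * _).
have /eqP := w0E i; rewrite eqxx -expr2 sqrf_eq1 => /orP[] /eqP ->.
  by apply: mean_ext => s; rewrite mulr1.
rewrite -[RHS]gauss_meanN.
- by apply: mean_ext => s; rewrite mulrN1.
- have := lsh 1; under eq_fun do rewrite mulr1.
  by case=> _ [L' _ h]; exact: lip_continuous h.
- by move=> s; case/andP: (li (y 0 i + s)).
Qed.

(** An isotropic family carries the same Gaussian average as the canonical
    basis, for which the average of a product factorises. *)
Lemma gauss_avg_prod n (chi : 'I_n -> R -> R) (ws : seq 'rV[R]_n) y :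
  (forall i, lip01R (chi i)) ->
  (forall j k, gram ws j k = (j == k)%:R) ->
  gauss_avg ws (fun y => \prod_i chi i (y 0 i)) y =
  \prod_i gauss_mean (fun s => chi i (y 0 i + s)).
Proof.
move=> lchi gramE; rewrite (@gauss_avg_prod_rec _ _ [set: 'I_n]%SET)//.
  by apply: eq_bigr => i _; rewrite inE.
by move=> j k; rewrite inE andbT.
Qed.

End gauss_avg.

(** * The lazy walk followed by the selected colour *)

Section walk.
Context {R : realType} (m : nat) (p : 'I_m -> R).
Hypothesis p_ge0 : forall u, 0 <= p u.
Hypothesis p_sum1 : \sum_u p u = 1.

(** Expectation of [g] after [n] steps from [x], the [j]-th step being an
    increment with probability [1 / (j + 1)] and null otherwise. *)
Fixpoint walk_avg (V : zmodType) (step : 'I_m -> V) n (g : V -> R) (x : V) : R :=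
  if n is n'.+1 then
    (1 - n'.+2%:R^-1) * walk_avg step n' g x +
    n'.+2%:R^-1 * \sum_u p u * walk_avg step n' g (x + step u)
  else g x.

(** Expected number of increments among the first [n] steps. *)
Definition walk_intensity n : R := \sum_(j < n) j.+2%:R^-1.

Let q_itv n : 0 <= (n.+2%:R^-1 : R) <= 1.
Proof. by rewrite invr_ge0 ler0n/= invf_le1// ler1n. Qed.

Let q_ge0 n : 0 <= (n.+2%:R^-1 : R).
Proof. by case/andP: (q_itv n). Qed.

Let q_le1 n : 0 <= 1 - (n.+2%:R^-1 : R).
Proof. by rewrite subr_ge0; case/andP: (q_itv n). Qed.

Section avg.
Variables (V : zmodType) (step : 'I_m -> V).
Local Notation A := (walk_avg step).

Lemma walk_avg_ext n g1 g2 x : g1 =1 g2 -> A n g1 x = A n g2 x.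
Proof. by move=> /funext ->. Qed.

Lemma walk_avgD n g1 g2 x : A n (fun z => g1 z + g2 z) x = A n g1 x + A n g2 x.
Proof.
elim: n x => //= n IH x; rewrite IH.
under eq_bigr do rewrite IH mulrDr.
by rewrite big_split/=; ring.
Qed.

Lemma walk_avgZ n c g x : A n (fun z => c * g z) x = c * A n g x.
Proof.
elim: n x => //= n IH x; rewrite IH.
under eq_bigr do rewrite IH mulrCA.
by rewrite -mulr_sumr; ring.
Qed.

Lemma walk_avgB n g1 g2 x : A n (fun z => g1 z - g2 z) x = A n g1 x - A n g2 x.
Proof.
rewrite -[in RHS]mulN1r -walk_avgZ -walk_avgD.
by apply: walk_avg_ext => z; rewrite mulN1r.
Qed.

Lemma walk_avg_cst n c x : A n (fun=> c) x = c.
Proof.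
elim: n x => //= n IH x; rewrite IH.
by under eq_bigr do rewrite IH; rewrite -mulr_suml p_sum1; ring.
Qed.

Lemma walk_avg_le n g1 g2 x : (forall z, g1 z <= g2 z) -> A n g1 x <= A n g2 x.
Proof.
move=> g12; elim: n x => //= n IH x.
rewrite lerD// ler_wpM2l//; apply: ler_sum => u _; exact: ler_wpM2l.
Qed.

Lemma walk_avg_norm n g x : `|A n g x| <= A n (fun z => `|g z|) x.
Proof.
rewrite ler_norml -mulN1r -walk_avgZ !walk_avg_le// => z.
- exact: ler_norm.
- by rewrite mulN1r lerNl -normrN ler_norm.
Qed.

Lemma walk_avg_norm_le n g x (M : R) : (forall z, `|g z| <= M) -> `|A n g x| <= M.
Proof.
move=> gM; apply: le_trans (walk_avg_norm _ _ _) _.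
by rewrite -[leRHS](walk_avg_cst n M x); exact: walk_avg_le.
Qed.

Lemma walk_avg_succ_dist n g x (M : R) : (forall z, `|g z| <= M) ->
  `|A n.+1 g x - A n g x| <= 2 * n.+2%:R^-1 * M.
Proof.
move=> gM /=; set q := n.+2%:R^-1; set S := \sum_u _.
have SM : `|S| <= M.
  apply: le_trans (ler_norm_sum _ _ _) _.
  rewrite -[leRHS]mul1r -p_sum1 mulr_suml; apply: ler_sum => u _.
  by rewrite normrM ger0_norm// ler_wpM2l// walk_avg_norm_le.
rewrite (_ : _ - _ = q * (S - A n g x)); last by ring.
rewrite normrM (ger0_norm (q_ge0 n)) (mulrC 2) -mulrA ler_wpM2l//.
rewrite (le_trans (ler_normB _ _))// (_ : 2 * M = M + M); last by ring.
by rewrite lerD// walk_avg_norm_le.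
Qed.

Lemma walk_avg_mean n w (F : R -> V -> R) x : density w ->
  (forall z, bounded_mfun (F ^~ z)) ->
  bounded_mfun (fun s => A n (F s) x) /\
  mean w (fun s => A n (F s) x) = A n (fun z => mean w (F ^~ z)) x.
Proof.
move=> dw bF; elim: n x => [x|n IH x] /=; first by split.
have b1 y : bounded_mfun (fun s => A n (F s) y) by have [] := IH y.
have b2 : bounded_mfun (fun s => \sum_u p u * A n (F s) (x + step u)).
  apply: (@bounded_mfun_sum R _ _ (fun u s => p u * A n (F s) (x + step u))) => u.
  exact: bounded_mfunZ.
split; first by apply: bounded_mfunD; exact: bounded_mfunZ.
rewrite meanD//; try exact: bounded_mfunZ.
rewrite !meanZ// mean_sum//; last by move=> u; exact: bounded_mfunZ.
have [_ ->] := IH x; congr (_ + _ * _); apply: eq_bigr => u _.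
by rewrite meanZ//; have [_ ->] := IH (x + step u).
Qed.

End avg.

Lemma walk_avg_morph (V V' : zmodType) (step : 'I_m -> V) (step' : 'I_m -> V')
    (th : V' -> V) n g x : (forall z u, th (z + step' u) = th z + step u) ->
  walk_avg step n g (th x) = walk_avg step' n (g \o th) x.
Proof.
move=> thD; elim: n x => //= n IH x; rewrite IH.
by under eq_bigr do rewrite -thD IH.
Qed.

Lemma walk_avg_translate (V : zmodType) (step : 'I_m -> V) n g x v :
  walk_avg step n g (x + v) = walk_avg step n (fun z => g (z + v)) x.
Proof. by apply: (walk_avg_morph (th := +%R^~ v)) => z u; rewrite addrAC. Qed.

(** Lifting the walk to [R ^ m], with the canonical basis as increments,
    records in each coordinate how often each increment occurred. *)
Definition unit_vec (u : 'I_m) : 'rV[R]_m := delta_mx 0 u.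

Local Notation E := (walk_avg unit_vec).

Lemma count_mean n u (x : 'rV[R]_m) :
  E n (fun z : 'rV[R]_m => z 0 u - x 0 u) x = walk_intensity n * p u.
Proof.
rewrite /walk_intensity; elim: n x => [|n IH] x /=.
  by rewrite big_ord0 mul0r subrr.
rewrite IH big_ord_recr/=.
have e v : E n (fun z : 'rV[R]_m => z 0 u - x 0 u) (x + unit_vec v) =
    \sum_(j < n) j.+2%:R^-1 * p u + (u == v)%:R.
  transitivity (E n (fun z : 'rV[R]_m => (z 0 u - (x + unit_vec v) 0 u) + (u == v)%:R)
      (x + unit_vec v)).
    by apply: walk_avg_ext => z; rewrite !mxE eqxx/= eq_sym; ring.
  by rewrite walk_avgD walk_avg_cst IH -mulr_suml.
rewrite (eq_bigr (fun v => p v * (walk_intensity n * p u) + p v * (u == v)%:R)); last first.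
  by move=> v _; rewrite -mulrDr; congr (_ * _); rewrite /walk_intensity mulr_suml; exact: e.
rewrite -/(walk_intensity n).
rewrite big_split/= -!mulr_suml p_sum1 (bigD1 u)//= eqxx mulr1 big1 ?addr0.
  by ring.
by move=> v vu; rewrite eq_sym (negbTE vu) mulr0.
Qed.

Lemma count_second_moment n u (x : 'rV[R]_m) :
  E n (fun z : 'rV[R]_m => (z 0 u - x 0 u) ^+ 2) x <=
  (walk_intensity n * p u) ^+ 2 + walk_intensity n * p u.
Proof.
rewrite /walk_intensity; elim: n x => [|n IH] x /=.
  by rewrite big_ord0 mul0r subrr expr0n addr0.
rewrite big_ord_recr/= -/(walk_intensity n).
rewrite -/(walk_intensity n) in IH.
set l := walk_intensity n; set q := n.+2%:R^-1; set B := (l * p u) ^+ 2 + l * p u.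
have e v : E n (fun z : 'rV[R]_m => (z 0 u - x 0 u) ^+ 2) (x + unit_vec v) <=
    B + (u == v)%:R * (2 * l * p u + 1).
  pose y := x + unit_vec v.
  have -> : E n (fun z : 'rV[R]_m => (z 0 u - x 0 u) ^+ 2) y =
      E n (fun z : 'rV[R]_m => (z 0 u - y 0 u) ^+ 2) y +
      (u == v)%:R * (2 * E n (fun z : 'rV[R]_m => z 0 u - y 0 u) y + 1).
    transitivity (E n (fun z : 'rV[R]_m => (z 0 u - y 0 u) ^+ 2 +
        (u == v)%:R * (2 * (z 0 u - y 0 u) + 1)) y).
      apply: walk_avg_ext => z; rewrite !mxE eqxx/= eq_sym.
      by case: (v == u) => /=; ring.
    by rewrite walk_avgD walk_avgZ walk_avgD walk_avgZ walk_avg_cst.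
  by rewrite count_mean lerD// -/l mulrA.
apply: (@le_trans _ _ ((1 - q) * B + q * (B + p u * (2 * l * p u + 1)))).
  apply: lerD; first by apply: ler_wpM2l; [exact: q_le1|exact: IH].
  apply: ler_wpM2l; first exact: q_ge0.
  apply: (@le_trans _ _ (\sum_v (p v * B + p v * ((u == v)%:R * (2 * l * p u + 1))))).
    by apply: ler_sum => v _; rewrite -mulrDr; apply: ler_wpM2l => //; exact: e.
  rewrite big_split/= -mulr_suml p_sum1 mul1r lerD2l (bigD1 u)//= eqxx mul1r.
  by rewrite big1 ?addr0// => v vu; rewrite eq_sym (negbTE vu) mul0r mulr0.
rewrite -subr_ge0 (_ : _ - _ = (q * p u) ^+ 2); first exact: sqr_ge0.
by rewrite /B; ring.
Qed.

(** Size bias: were the increment counts independent Poisson variables, weighting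
    by the count of [u] would exactly amount to one more increment [u]. Here
    each step contributes an error of the order of its probability squared,
    and these are summable. *)
Lemma count_size_bias n u (g : 'rV[R]_m -> R) (x : 'rV[R]_m) (M : R) : (forall z, `|g z| <= M) ->
  `|E n (fun z : 'rV[R]_m => (z 0 u - x 0 u) * g z) x -
    walk_intensity n * p u * E n g (x + unit_vec u)| <= 2 * M.
Proof.
move=> gM; have M0 : 0 <= M by apply: le_trans (gM 0).
suff H : `|E n (fun z : 'rV[R]_m => (z 0 u - x 0 u) * g z) x -
    walk_intensity n * p u * E n g (x + unit_vec u)| <= 2 * (1 - n.+1%:R^-1) * M.
  by rewrite (le_trans H)// ler_wpM2r// ler_piMr// lerBlDr lerDl invr_ge0 ler0n.
have p_le1 : p u <= 1.
  by rewrite -p_sum1 (bigD1 u)//= lerDl sumr_ge0.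
rewrite /walk_intensity; elim: n x => [|n IH] x.
  by rewrite big_ord0 /= subrr !mul0r subrr normr0 invr1 subrr mulr0 mul0r.
rewrite big_ord_recr/= -/(walk_intensity n).
rewrite -/(walk_intensity n) in IH.
set l := walk_intensity n; set q := n.+2%:R^-1.
set W := fun y : 'rV[R]_m => E n (fun z : 'rV[R]_m => (z 0 u - y 0 u) * g z) y.
have e v : E n (fun z : 'rV[R]_m => (z 0 u - x 0 u) * g z) (x + unit_vec v) =
    W (x + unit_vec v) + (u == v)%:R * E n g (x + unit_vec v).
  rewrite /W -walk_avgZ -walk_avgD; apply: walk_avg_ext => z.
  by rewrite !mxE eqxx/= eq_sym; ring.
rewrite [walk_avg _ _ _ _]/=.
rewrite (eq_bigr (fun v => p v * W (x + unit_vec v) +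
    p v * ((u == v)%:R * E n g (x + unit_vec v)))); last first.
  by move=> v _; rewrite -mulrDr; congr (_ * _); exact: e.
have eu : \sum_v p v * ((u == v)%:R * E n g (x + unit_vec v)) =
    p u * E n g (x + unit_vec u).
  rewrite (bigD1 u)//= eqxx mul1r big1 ?addr0// => v vu.
  by rewrite eq_sym (negbTE vu) mul0r mulr0.
rewrite big_split/= eu.
rewrite -/(W x); set xu := x + unit_vec u.
pose D (y : 'rV[R]_m) := W y - l * p u * E n g (y + unit_vec u).
have Dle y : `|D y| <= 2 * (1 - n.+1%:R^-1) * M by exact: IH.
set B := 2 * _ * M in Dle.
have succ := walk_avg_succ_dist unit_vec n xu gM.
rewrite /= -/q in succ.
set T := \sum_v p v * W _; set S := \sum_u0 p u0 * E n g _ in succ *.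
have TS : T = \sum_v p v * D (x + unit_vec v) + l * p u * S.
  rewrite mulr_sumr -big_split/=; apply: eq_bigr => v _.
  by rewrite /D /xu addrAC; ring.
rewrite (_ : _ - _ = (1 - q) * D x + q * (\sum_v p v * D (x + unit_vec v)) -
    q * p u * ((1 - q) * E n g xu + q * S - E n g xu)); last first.
  by rewrite TS /D -/xu; ring.
have Dsum : `|\sum_v p v * D (x + unit_vec v)| <= B.
  apply: le_trans (ler_norm_sum _ _ _) _.
  rewrite -[leRHS]mul1r -p_sum1 mulr_suml; apply: ler_sum => v _.
  by rewrite normrM ger0_norm//; apply: ler_wpM2l => //; exact: Dle.
apply: (@le_trans _ _ ((1 - q) * B + q * B + q * (2 * q * M))).
  rewrite (le_trans (ler_normB _ _))// lerD//.
    rewrite (le_trans (ler_normD _ _))// !normrM (ger0_norm (q_ge0 n)) (ger0_norm (q_le1 n)).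
    by apply: lerD; apply: ler_wpM2l => //; exact: Dle.
  rewrite !normrM (ger0_norm (q_ge0 n)) (ger0_norm (p_ge0 u)) -mulrA.
  apply: ler_wpM2l => //; rewrite -[leRHS]mul1r; exact: ler_pM.
rewrite -mulrDl subrK mul1r /B.
rewrite (_ : _ + _ = 2 * (1 - n.+1%:R^-1 + q * q) * M); last by ring.
have qq : q * q <= n.+1%:R^-1 - q.
  rewrite /q (_ : n.+1%:R^-1 - n.+2%:R^-1 = n.+1%:R^-1 * n.+2%:R^-1 :> R).
    by rewrite ler_wpM2r// lef_pV2 ?posrE ?ltr0n// ler_nat.
  have a0 : 0 < (n.+1%:R : R) by rewrite ltr0n.
  rewrite -(natr1 n.+1); move: (n.+1%:R : R) a0 => a a0.
  by field; rewrite !gt_eqF// ltr_wpDr.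
by rewrite ler_wpM2r// ler_wpM2l// -addrA lerD2l addrC lerBlDl.
Qed.

End walk.

(** * Replacing the counts by Gaussian variables, one coordinate at a time *)

Section swap.
Context {R : realType}.

Section ops.
Variables (m : nat) (p : 'I_m -> R) (l : R).
Local Notation ev := (@unit_vec R m).

Definition set_coord u b (x : 'rV[R]_m) : 'rV[R]_m := x + (b - x 0 u) *: ev u.

(** Spreading the count of [u] uniformly over a unit interval makes its lattice
    law comparable to a Gaussian one, whatever the Lipschitz constant of [g]. *)
Definition smooth u (g : 'rV[R]_m -> R) x := unit_mean (fun t => g (x + t *: ev u)).

(** The count of [u] is replaced by a normal variable with the mean and variance
    [l * p u] of the corresponding Poisson variable. *)
Definition resample u (g : 'rV[R]_m -> R) x :=
  gauss_mean (fun s => g (set_coord u (l * p u + Num.sqrt (l * p u) * s) x)).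

Lemma set_coordE u b x i : set_coord u b x 0 i = if i == u then b else x 0 i.
Proof.
rewrite !mxE eqxx/=; case: eqVneq => [->|_]; last by rewrite mulr0 addr0.
by rewrite mulr1 addrC subrK.
Qed.

Lemma set_coordC u v b c x : u != v ->
  set_coord v c (set_coord u b x) = set_coord u b (set_coord v c x).
Proof.
move=> uv; apply/rowP => i; rewrite !set_coordE.
by case: (eqVneq i v) => [->|//]; rewrite eq_sym (negbTE uv).
Qed.

Lemma set_coord_line u v b t x : u != v ->
  set_coord u b x + t *: ev v = set_coord u b (x + t *: ev v).
Proof.
move=> uv; apply/rowP => i; rewrite [RHS]set_coordE [LHS]mxE set_coordE !mxE eqxx/=.
by case: (eqVneq i u) => [->|//]; rewrite (negbTE uv) mulr0 addr0.
Qed.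

Lemma set_coord_shift u b t x : set_coord u b (x + t *: ev u) = set_coord u b x.
Proof.
apply/rowP => i; rewrite !set_coordE !mxE eqxx/=.
by case: (eqVneq i u) => [//|]; rewrite mulr0 addr0.
Qed.

Lemma set_coord_affine u a c s x : set_coord u (a + c * s) x = set_coord u a x + s *: (c *: ev u).
Proof.
apply/rowP => i; rewrite [RHS]mxE !set_coordE !mxE eqxx/=.
case: (eqVneq i u) => [_|_]; last by rewrite !mulr0 addr0.
by rewrite mulr1 mulrC.
Qed.

Lemma set_coord_lip u b x y : l1_norm (set_coord u b x - set_coord u b y) <= l1_norm (x - y).
Proof.
apply: ler_sum => i _; rewrite !mxE -!/(set_coord u b _) eqxx/=.
case: (eqVneq i u) => [->|_]; last by rewrite !mulr0 !addr0.
by rewrite !mulr1 [_ + (b - _)]addrC subrK [_ + (b - _)]addrC subrK subrr normr0.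
Qed.

Lemma lip01_set_coord u b g : lip01 g -> lip01 (g \o set_coord u b).
Proof.
move=> [g01 [L L0 gL]]; split; first by move=> x; exact: g01.
by exists L => // x y; rewrite (le_trans (gL _ _))// ler_wpM2l// set_coord_lip.
Qed.

Lemma lip01_smooth u g : lip01 g -> lip01 (smooth u g).
Proof.
move=> lg; have [g01 [L L0 gL]] := lg.
apply: (@lip01_mean _ _ _ (fun t x => g (x + t *: ev u)) L) => //.
- exact: density_unit.
- by move=> s x y /=; apply: (le_trans (gL _ _)); rewrite opprD addrACA subrr addr0.
- by move=> x; apply: lip01R_bounded; exact: lip01_line.
Qed.

Lemma resample_bounded u g x : lip01 g ->
  bounded_mfun (fun s => g (set_coord u (l * p u + Num.sqrt (l * p u) * s) x)).
Proof.
move=> lg; apply: lip01R_bounded; under eq_fun do rewrite set_coord_affine.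
exact: lip01_line.
Qed.

Lemma lip01_resample u g : lip01 g -> lip01 (resample u g).
Proof.
move=> lg; have [g01 [L L0 gL]] := lg.
apply: (@lip01_mean _ _ _
  (fun s x => g (set_coord u (l * p u + Num.sqrt (l * p u) * s) x)) L) => //.
- exact: density_phi.
- by move=> s x y /=; rewrite (le_trans (gL _ _))// ler_wpM2l// set_coord_lip.
- by move=> x; exact: resample_bounded.
Qed.

Definition smooths us g := foldr smooth g us.
Definition resamples us g := foldr resample g us.

Lemma lip01_smooths us g : lip01 g -> lip01 (smooths us g).
Proof. by move=> lg; elim: us => [|u us IH] //=; exact: lip01_smooth. Qed.

Lemma lip01_resamples us g : lip01 g -> lip01 (resamples us g).
Proof. by move=> lg; elim: us => [|u us IH] //=; exact: lip01_resample. Qed.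

Lemma smooths_set_coord u b us g : u \notin us ->
  smooths us (g \o set_coord u b) = smooths us g \o set_coord u b.
Proof.
elim: us => [//|v us IH]; rewrite inE negb_or => /andP[uv uus].
rewrite [LHS]/= (IH uus).
by apply/funext => x; apply: mean_ext => t /=; rewrite set_coord_line.
Qed.

Lemma resamples_set_coord u b us g : u \notin us ->
  resamples us (g \o set_coord u b) = resamples us g \o set_coord u b.
Proof.
elim: us => [//|v us IH]; rewrite inE negb_or => /andP[uv uus].
rewrite [LHS]/= (IH uus).
by apply/funext => x; apply: mean_ext => s /=; rewrite (set_coordC _ _ _ uv).
Qed.

(** A resampled coordinate is forgotten. *)
Lemma resamples_eq us g (x y : 'rV[R]_m) : (forall i, i \notin us -> x 0 i = y 0 i) ->
  resamples us g x = resamples us g y.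
Proof.
elim: us x y => [|u us IH] x y xy /=.
  by congr g; apply/rowP => i; exact: xy.
apply: mean_ext => s; apply: IH => i ius; rewrite !set_coordE.
by case: eqVneq => // iu; apply: xy; rewrite inE negb_or iu.
Qed.

End ops.

(** Stein's equation in the coordinate [u], whose solution is evaluated at the
    normalised count [xi]. In expectation the two main terms
    [s * (F (z + e) - F z)] and [xi z * F z] cancel by the size-bias identity, and
    the remainder is at most a multiple of [1 + xi z ^+ 2], whose expectation is
    bounded. *)
Lemma stein_swap : exists2 C : R, 0 < C & forall m (p : 'I_m -> R) n u l g,
  (forall u, 0 <= p u) -> \sum_u p u = 1 ->
  2^-1 <= l -> `|walk_intensity n - l| <= 1 -> 0 < p u -> lip01 g ->
  `|walk_avg p (@unit_vec R m) n (smooth u g) 0 -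
    walk_avg p (@unit_vec R m) n (resample p l u g) 0| <= C / Num.sqrt (l * p u).
Proof.
have [C0 C00 stein] := @stein_smooth R.
exists (6 + 4 * C0); first by rewrite ltr_wpDl// mulr_gt0.
move=> m p n u l g p0 p1 l2 lam pu lg.
set A := walk_avg p _ n; set e := @unit_vec R m u.
have l0 : 0 < l by apply: lt_le_trans l2; rewrite invr_gt0.
pose a := l * p u; pose s := Num.sqrt a; pose lm := walk_intensity n : R.
have a0 : 0 < a by rewrite mulr_gt0.
have s0 : 0 < s by rewrite sqrtr_gt0.
have sN0 : s != 0 by rewrite gt_eqF.
have s2 : s * s = a by rewrite -expr2 sqr_sqrtr// ltW.
have pu1 : p u <= 1.
  by rewrite -p1 (bigD1 u)//= lerDl sumr_ge0.
(* [S h] is a solution of Stein's equation for [h], depending on [h] only. *)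
have /choice[S PS] : forall h : R -> R, exists f : R -> R,
    continuous h -> (forall x, 0 <= h x <= 1) ->
    [/\ forall x, `|f x| <= C0, continuous f &
    forall s xi, 0 < s ->
      `|unit_mean (fun t => h (xi + t / s)) - gauss_mean h
        - (s * (f (xi + s^-1) - f xi) - xi * f xi)| <= (2 * `|xi| + C0) / s].
  move=> h; have [[ch h01]|nh] := pselect (continuous h /\ (forall x, 0 <= h x <= 1)).
    by have [f Pf] := stein h ch h01; exists f.
  by exists h => ch h01; case: nh.
pose xi (z : 'rV[R]_m) := (z 0 u - a) / s.
(* [h z] does not see the count of [u] in [z], so neither does the solution
   [S (h z)]: in [F (z + e)] only the point of evaluation moves. *)
pose h (z : 'rV[R]_m) t := g (set_coord u (a + s * t) z).
pose F (z : 'rV[R]_m) := S (h z) (xi z).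
have ch z : continuous (h z).
  have := lip01_line (set_coord u a z) (s *: e) lg.
  rewrite /h; under eq_fun do rewrite -set_coord_affine.
  by case=> _ [L _ hL]; exact: lip_continuous hL.
have h01 z t : 0 <= h z t <= 1 by rewrite /h; case: lg.
have FC z : `|F z| <= C0 by have [H _ _] := PS (h z) (ch z) (h01 z); exact: H.
have eu : e 0 u = 1 by rewrite /e /unit_vec mxE !eqxx.
have hshift z t : h (z + t *: e) = h z.
  by apply/funext => r; rewrite /h set_coord_shift.
pose Delta z := smooth u g z - resample p l u g z - (s * (F (z + e) - F z) - xi z * F z).
have pt z : `|Delta z| <= (1 + xi z ^+ 2 + C0) / s.
  have [_ _ /(_ s (xi z) s0)] := PS (h z) (ch z) (h01 z).
  have -> : (fun t => h z (xi z + t / s)) = (fun t => g (z + t *: e)).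
    apply/funext => t; rewrite /h; congr g; apply/rowP => i; rewrite set_coordE !mxE eqxx/=.
    case: eqVneq => [->|_]; last by rewrite mulr0 addr0.
    by rewrite /xi mulr1; field.
  have -> : S (h z) (xi z + s^-1) = F (z + e).
    rewrite /F; congr S; first by rewrite -(hshift z 1) scale1r.
    by rewrite /xi mxE eu; field.
  move=> H; apply: (le_trans H); rewrite ler_pM2r ?invr_gt0// lerD2r.
  rewrite -(real_normK (num_real (xi z))).
  have : 0 <= (`|xi z| - 1) ^+ 2 by rewrite sqr_ge0.
  by rewrite sqrrB1; lra.
have zu0 (G : 'rV[R]_m -> R) : A (fun z => (z 0 u - (0 : 'rV[R]_m) 0 u) * G z) 0 =
    A (fun z => z 0 u * G z) 0.
  by apply: walk_avg_ext => z; rewrite mxE subr0.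
have Azu : A (fun z => z 0 u) 0 = lm * p u.
  rewrite -(count_mean p1 n u 0); apply: walk_avg_ext => z.
  by rewrite mxE subr0.
have Azu2 : A (fun z => z 0 u ^+ 2) 0 <= (lm * p u) ^+ 2 + lm * p u.
  have := count_second_moment p0 p1 n u 0; apply: le_trans.
  by rewrite le_eqVlt; apply/orP; left; apply/eqP; apply: walk_avg_ext => z; rewrite mxE subr0.
have Axi2 : A (fun z => xi z ^+ 2) 0 <= 5.
  have -> : A (fun z => xi z ^+ 2) 0 =
      a^-1 * (A (fun z => z 0 u ^+ 2) 0 + (- (2 * a) * (lm * p u) + a ^+ 2)).
    rewrite -Azu -walk_avgZ -[a ^+ 2](walk_avg_cst p1 (@unit_vec R m) n _ 0).
    rewrite -walk_avgD -walk_avgD -walk_avgZ; apply: walk_avg_ext => z.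
    by rewrite /xi exprMn exprVn (expr2 s) s2; field; rewrite gt_eqF.
  rewrite ler_pdivrMl//; apply: (@le_trans _ _ (((lm - l) * p u) ^+ 2 + lm * p u)).
    rewrite (_ : ((lm - l) * p u) ^+ 2 + lm * p u =
      (lm * p u) ^+ 2 + lm * p u + (- (2 * a) * (lm * p u) + a ^+ 2)) ?lerD2r//.
    by rewrite /a; ring.
  have : ((lm - l) * p u) ^+ 2 <= p u.
    rewrite -(real_normK (num_real _)) normrM (gtr0_norm pu) expr2.
    rewrite -[leRHS]mul1r ler_pM// ?mulr_ge0 ?(ltW pu)//.
    + by rewrite -[leRHS]mulr1 ler_pM ?(ltW pu).
    + by rewrite ler_piMl// ltW.
  have : lm * p u <= (l + 1) * p u.
    rewrite ler_pM2r//; move: lam; rewrite ler_norml -/lm; lra.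
  have : (l + 2) * p u <= (l * 5) * p u by rewrite ler_pM2r//; lra.
  by rewrite /a; lra.
have ADelta : `|A Delta 0| <= (6 + C0) / s.
  apply: (le_trans (walk_avg_norm p0 _ _ _ _)).
  apply: (le_trans (walk_avg_le p0 _ _ _ pt)).
  rewrite (_ : walk_avg _ _ _ _ _ = s^-1 * (1 + C0 + A (fun z => xi z ^+ 2) 0)); last first.
    rewrite -[1 + C0](walk_avg_cst p1 (@unit_vec R m) n _ 0) -walk_avgD -walk_avgZ.
    by apply: walk_avg_ext => z; ring.
  by rewrite mulrC ler_pM2r ?invr_gt0//; lra.
have AF : `|A (fun z => z 0 u * F z) 0 - lm * p u * A F e| <= 2 * C0.
  have := count_size_bias p0 p1 n u 0 FC; rewrite add0r; apply: le_trans.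
  by rewrite -zu0.
have AFe : A (fun z => F (z + e)) 0 = A F e.
  by rewrite -[in RHS](add0r e); exact/esym/walk_avg_translate.
have AxiF : A (fun z => xi z * F z) 0 = s^-1 * (A (fun z => z 0 u * F z) 0 - a * A F 0).
  rewrite -walk_avgZ -walk_avgB -walk_avgZ; apply: walk_avg_ext => z.
  by rewrite /xi; ring.
have AFC : `|A F e| <= C0 by exact: walk_avg_norm_le.
(* Size bias replaces [z 0 u] by [lm * p u] and a shift by [e]; since
   [s * s = l * p u], what is left is [(l - lm) * p u * A F e] and the error of
   the size-bias identity. *)
have main : `|s * (A F e - A F 0) - A (fun z => xi z * F z) 0| <= 3 * C0 / s.
  rewrite AxiF (_ : _ - _ = s^-1 * ((l - lm) * p u * A F e -
      (A (fun z => z 0 u * F z) 0 - lm * p u * A F e))); last first.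
    rewrite (_ : (l - lm) * p u = s * s - lm * p u); last by rewrite s2 /a; ring.
    by rewrite -s2; field.
  rewrite normrM (gtr0_norm (_ : 0 < s^-1)) ?invr_gt0// mulrC.
  rewrite ler_pM2r ?invr_gt0// (le_trans (ler_normB _ _))//.
  rewrite (_ : 3 * C0 = C0 + 2 * C0); last by ring.
  apply: lerD => //; rewrite normrM -[leRHS]mul1r ler_pM//.
  by rewrite normrM (gtr0_norm pu) -[leRHS]mul1r; apply: ler_pM => //; rewrite distrC.
have -> : A (smooth u g) 0 - A (resample p l u g) 0 =
    A Delta 0 + (s * (A F e - A F 0) - A (fun z => xi z * F z) 0).
  have -> : A Delta 0 = A (smooth u g) 0 - A (resample p l u g) 0 -
      (s * (A (fun z => F (z + e)) 0 - A F 0) - A (fun z => xi z * F z) 0).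
    by rewrite /A -!walk_avgB -walk_avgZ -!walk_avgB.
  by rewrite AFe subrK.
rewrite (le_trans (ler_normD _ _))//.
rewrite (_ : 6 + 4 * C0 = 6 + C0 + 3 * C0); last by ring.
by rewrite mulrDl lerD.
Qed.

(** The walk average stays that of the original walk throughout: smoothing and
    resampling in different coordinates commute, so the coordinates already
    treated are merely part of the test function. *)
Lemma stein_swaps : exists2 C : R, 0 < C & forall m (p : 'I_m -> R) n us l g,
  (forall u, 0 < p u) -> \sum_u p u = 1 ->
  2^-1 <= l -> `|walk_intensity n - l| <= 1 -> uniq us -> lip01 g ->
  `|walk_avg p (@unit_vec R m) n (smooths us g) 0 -
    walk_avg p (@unit_vec R m) n (resamples p l us g) 0| <=
  \sum_(u <- us) C / Num.sqrt (l * p u).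
Proof.
have [C C0 swap] := stein_swap; exists C => // m p n us l g pgt0 p1 l2 lam.
have p0 u : 0 <= p u by exact: ltW.
elim: us g => [|u us IH] g; first by rewrite big_nil subrr normr0.
rewrite cons_uniq => /andP[uus uniq_us] lg; rewrite big_cons /=.
have ls := lip01_smooths us lg; have lr := lip01_resamples p l us lg.
rewrite -(subrKA (walk_avg p (@unit_vec R m) n (resample p l u (smooths us g)) 0)).
apply: le_trans (ler_normD _ _) _; apply: lerD; first exact: swap.
pose b s := l * p u + Num.sqrt (l * p u) * s.
have [bs sE] := @walk_avg_mean R m p _ (@unit_vec R m) n _
  (fun s => smooths us g \o set_coord u (b s)) 0 density_phi
  (fun z => resample_bounded p l u z ls).
have [br rE] := @walk_avg_mean R m p _ (@unit_vec R m) n _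
  (fun s => resamples p l us g \o set_coord u (b s)) 0 density_phi
  (fun z => resample_bounded p l u z lr).
rewrite /resample /gauss_mean -sE -rE; apply: mean_dist => //; first exact: density_phi.
by move=> s; rewrite -smooths_set_coord// -resamples_set_coord// IH//; exact: lip01_set_coord.
Qed.

End swap.

(** * Comparison of distribution functions *)

Section cdf.
Context {R : realType}.
Local Notation mu := (@lebesgue_measure R).
Local Notation phi := (@normal_pdf R 0 1).

Definition gauss_cdf (x : R) : R := fine (normal_prob 0 1 `]-oo, x]).

Lemma gauss_mean_cdf c : bounded_mfun (\1_`]-oo, c] : R -> R) /\
  gauss_mean \1_`]-oo, c] = gauss_cdf c.
Proof.
split.
  split; [exact: measurable_indic|exists 1 => x; rewrite indicE].
  by case: (_ \in _) => /=; rewrite ?normr1 ?normr0.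
rewrite /gauss_mean /mean /gauss_cdf /normal_prob -/(Rintegral _ _ _).
rewrite [RHS]Rintegral_mkcond; apply: eq_Rintegral => x _.
by rewrite indicE patchE; case: ifPn; rewrite ?mul1r ?mul0r.
Qed.

Lemma gauss_cdf_itv c : 0 <= gauss_cdf c <= 1.
Proof.
have [b <-] := gauss_mean_cdf c; apply: mean_itv => //; first exact: density_phi.
by move=> x; rewrite indicE; case: (_ \in _); rewrite ?lexx ?ler01.
Qed.

Lemma gauss_cdf_lip x y : `|gauss_cdf x - gauss_cdf y| <= `|x - y|.
Proof.
wlog xy : x y / x <= y.
  by move=> H; have [/H//|/ltW/H] := leP x y; rewrite distrC (distrC y).
rewrite distrC (distrC x) [leRHS]ger0_norm ?subr_ge0//.
have iphi (D : set R) : measurable D -> mu.-integrable D (EFin \o phi).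
  by move=> mD; apply: integrableS (integrable_normal_pdf 0 1).
have -> : gauss_cdf y - gauss_cdf x = \int[mu]_(t in `]x, y]) phi t.
  rewrite /gauss_cdf /normal_prob -!/(Rintegral _ _ _).
  by rewrite Rintegral_itvB//; exact: iphi.
rewrite ger0_norm; last by apply: Rintegral_ge0 => t _; exact: normal_pdf_ge0.
apply: (@le_trans _ _ (\int[mu]_(t in `]x, y]) 1)).
  apply: le_Rintegral => //; first exact: iphi.
    apply: (@integrableS _ _ _ mu `[x, y]) => //; first exact: subset_itv_oc_cc.
    apply: continuous_compact_integrable; first exact: segment_compact.
    by apply: continuous_subspaceT => z; exact: cvg_cst.
  move=> t _; rewrite (le_trans (normal_pdf_ub _ _ (oner_neq0 _)))//.
  rewrite /normal_peak invf_le1 ?sqrtr_gt0; last first.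
    by rewrite mulrn_wgt0// mulr_gt0 ?pi_gt0.
  rewrite -[leLHS]sqrtr1 ler_wsqrtr// expr1n mul1r.
  have := @pi_ge2 R; rewrite -mulr_natr; lra.
rewrite Rintegral_cst//= mul1r lebesgue_measure_itv/= lte_fin.
case: ifPn => [_|]; first by [].
by rewrite subr_ge0.
Qed.

(** Lipschitz approximation of the indicator of [y <= x]. *)
Definition ramp (x e y : R) : R := Num.max 0 (Num.min 1 (1 - (y - x) / e)).

Lemma ramp_itv x e y : 0 <= ramp x e y <= 1.
Proof.
rewrite /ramp le_max lexx/= ge_max ler01/= ge_min lexx. by [].
Qed.

Lemma ramp1 x e y : 0 < e -> y <= x -> ramp x e y = 1.
Proof.
move=> e0 yx; rewrite /ramp min_l ?max_r// lerBrDl.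
by rewrite -lerBrDr subrr pmulr_lle0 ?invr_gt0// subr_le0.
Qed.

Lemma ramp0 x e y : 0 < e -> x + e <= y -> ramp x e y = 0.
Proof.
move=> e0 xy; rewrite /ramp max_l// ge_min; apply/orP; right.
by rewrite subr_le0 ler_pdivlMr// mul1r lerBrDl.
Qed.

Lemma lip01R_ramp x e : 0 < e -> lip01R (ramp x e).
Proof.
move=> e0; split; first exact: ramp_itv.
exists e^-1 => [|y z]; first by rewrite invr_ge0 ltW.
wlog yz : y z / y <= z.
  by move=> H; have [/H//|/ltW/H] := leP y z; rewrite distrC (distrC z).
have yz' : (y - x) / e <= (z - x) / e.
  by rewrite ler_pM2r ?invr_gt0// lerD2r.
rewrite (distrC y) (ger0_norm (_ : 0 <= z - y)) ?subr_ge0//.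
rewrite (_ : e^-1 * (z - y) = (z - x) / e - (y - x) / e); last by ring.
rewrite /ramp; move: yz'; move: ((y - x) / e) ((z - x) / e) => a b ab.
rewrite ler_norml !maxEle !minEle.
case: (leP 1 (1 - a)) => ?; case: (leP 1 (1 - b)) => ?; case: (leP 0 (1 - a)) => ?;
  case: (leP 0 (1 - b)) => ?; rewrite ?ler01 //; apply/andP; split; lra.
Qed.

Lemma gauss_mean_ramp x e b : 0 < e ->
  gauss_cdf (x - b) <= gauss_mean (fun s => ramp x e (b + s)) <= gauss_cdf (x + e - b).
Proof.
move=> e0; have br := lip01R_bounded (lip01R_shift b (lip01R_ramp x e0)).
have [b1 <-] := gauss_mean_cdf (x - b); have [b2 <-] := gauss_mean_cdf (x + e - b).
rewrite !mean_le//; try exact: density_phi.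
- move=> s; rewrite indicE mem_setE in_itv/=; case: (leP s (x + e - b)) => h.
    by case/andP: (ramp_itv x e (b + s)).
  by rewrite ramp0// (addrC b) -lerBlDr ltW.
- move=> s; rewrite indicE mem_setE in_itv/=; case: (leP s (x - b)) => h.
    by rewrite ramp1// (addrC b) -lerBrDr.
  by case/andP: (ramp_itv x e (b + s)).
Qed.

End cdf.

Section walk_cdf.
Context {R : realType}.

Lemma unit_mean_const (h : R -> R) c : (forall t, 0 <= t <= 1 -> h t = c) ->
  unit_mean h = c.
Proof.
move=> hc; rewrite unit_meanE -[RHS](mean_cst density_unit).
rewrite -/(unit_mean _) unit_meanE; apply: eq_Rintegral => t.
by rewrite inE/= in_itv/=; exact: hc.
Qed.

(** [smooths us] only looks at the unit box above the current point. *)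
Lemma smooths_const m us (g : 'rV[R]_m -> R) (x : 'rV[R]_m) c : uniq us ->
  (forall z : 'rV[R]_m, (forall i, if i \in us then is_true (0 <= z 0 i - x 0 i <= 1)
                        else z 0 i = x 0 i) -> g z = c) ->
  smooths us g x = c.
Proof.
elim: us x => [|u us IH] x /=; first by move=> _; apply.
move=> /andP[uus uniq_us] gc; apply: unit_mean_const => t t01.
apply: IH => // z hz; apply: gc => i; have := hz i.
rewrite inE !mxE eqxx/=; case: eqVneq => [->|iu] /=.
  rewrite (negbTE uus) mulr1 => ->.
  by rewrite addrAC subrr add0r.
by rewrite mulr0 addr0.
Qed.

Lemma resamples_gauss_avg m n (p : 'I_m -> R) l us (th : 'rV[R]_m -> 'rV[R]_n)
    (v : 'I_m -> 'rV[R]_n) f (x : 'rV[R]_m) :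
  uniq us -> lip01 f -> (forall u, u \in us -> x 0 u = l * p u) ->
  (forall z u s, th (z + s *: unit_vec u) = th z + s *: v u) ->
  resamples p l us (f \o th) x =
  gauss_avg [seq Num.sqrt (l * p u) *: v u | u <- us] f (th x).
Proof.
move=> + lf + thD; elim: us x => //= u us IH x /andP[uus uniq_us] xE.
apply: mean_ext => s; rewrite IH//.
- congr gauss_avg; rewrite set_coord_affine scalerA thD scalerA; congr (th _ + _).
  apply/rowP => i; rewrite set_coordE; case: eqVneq => [->|//].
  by rewrite xE ?mem_head.
- move=> w wus; rewrite set_coordE; case: eqVneq => [wu|_]; first by rewrite -wu wus in uus.
  by apply: xE; rewrite inE wus orbT.
Qed.

(** Replacing the indicator of an orthant by a product of ramps of width [e], as
    small as the spacing of the normalised walk, moves [x] by [O(e)] and allows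
    smoothing and resampling of the counts. Once every count is resampled, the
    increments have become a Gaussian average along the vectors
    [Num.sqrt (p u) *: v u], which are isotropic. *)
Lemma walk_cdf : exists2 C : R, 0 < C &
  forall m n (p : 'I_m -> R) (v : 'I_m -> 'rV[R]_n),
  (forall u, 0 < p u) -> \sum_u p u = 1 ->
  gram [seq Num.sqrt (p u) *: v u | u <- enum 'I_m] =2 (fun j k => (j == k)%:R) ->
  forall N (l Y : R) (x y : 'rV[R]_n), 2^-1 <= l -> `|walk_intensity N - l| <= 1 ->
  (forall i, `|y 0 i| <= Y / Num.sqrt l) ->
  `|walk_avg p (@unit_vec R m) N (fun z => [forall i, (y + (Num.sqrt l)^-1 *:
       \sum_u (z 0 u - l * p u) *: v u) 0 i <= x 0 i]%:R) 0 -
    \prod_i gauss_cdf (x 0 i)| <=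
  (\sum_u C / Num.sqrt (p u) + n%:R * (Y + 1 + \sum_u l1_norm (v u))) / Num.sqrt l.
Proof.
have [C C0 swaps] := @stein_swaps R; exists C => // m n p v pgt0 p1 gramE.
move=> N l Y x y l2 lam yY.
have l0 : 0 < l by apply: lt_le_trans l2; rewrite invr_gt0.
have p0 u : 0 <= p u by exact: ltW.
set K := \sum_u l1_norm (v u); set e := (Num.sqrt l)^-1.
have e0 : 0 < e by rewrite invr_gt0 sqrtr_gt0.
pose th (z : 'rV[R]_m) : 'rV[R]_n := y + e *: \sum_u (z 0 u - l * p u) *: v u.
pose G z : R := [forall i, th z 0 i <= x 0 i]%:R.
rewrite -/(G _) [X in walk_avg _ _ _ X](_ : _ = G)//.
set A := walk_avg p _ N.
have thD z u s : th (z + s *: unit_vec u) = th z + s *: (e *: v u).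
  have E1 : \sum_w ((z + s *: unit_vec u) 0 w - l * p w) *: v w =
      \sum_w (z 0 w - l * p w) *: v w + s *: v u.
    rewrite (bigD1 u)//= [in RHS](bigD1 u)//= !mxE !eqxx mulr1.
    rewrite [_ + s - _]addrAC; set b := z 0 u - _; rewrite scalerDl -!addrA.
    congr (_ + _); rewrite [LHS]addrC; congr (_ + _); apply: eq_bigr => w wu.
    by rewrite !mxE eqxx/= (negbTE wu) mulr0 addr0.
  by rewrite /th E1 scalerDr addrA; congr (_ + _); rewrite !scalerA mulrC.
have th_box (z z' : 'rV[R]_m) i : (forall u, 0 <= z' 0 u - z 0 u <= 1) ->
    `|th z' 0 i - th z 0 i| <= e * K.
  move=> box.
  have -> : th z' 0 i - th z 0 i = e * \sum_u (z' 0 u - z 0 u) * v u 0 i.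
    rewrite /th !mxE !summxE opprD addrACA subrr add0r -mulrBr; congr (_ * _).
    by rewrite -sumrB; apply: eq_bigr => u _; rewrite !mxE; ring.
  rewrite normrM (gtr0_norm e0) ler_pM2l//.
  apply: le_trans (ler_norm_sum _ _ _) _; apply: ler_sum => u _.
  have /andP[b0 b1] := box u.
  rewrite normrM (ger0_norm b0) (le_trans (ler_wpM2r _ b1))// mul1r.
  by rewrite /l1_norm (bigD1 i)//= lerDl sumr_ge0.
pose us := enum 'I_m.
have uus : uniq us by exact: enum_uniq.
have usT u : u \in us by rewrite mem_enum.
(* The point of mean counts, at which the affine map [th] takes the value [y]. *)
pose a : 'rV[R]_m := \row_u (l * p u).
have tha : th a = y.
  rewrite /th big1 ?scaler0 ?addr0// => u _; by rewrite !mxE subrr scale0r.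
pose H b (z : 'rV[R]_n) := \prod_i ramp (x 0 i + b) e (z 0 i).
have lH b : lip01 (H b).
  by apply: (lip01_prod (chi := fun i => ramp (x 0 i + b) e)) => i; exact: lip01R_ramp.
have lHth b : lip01 (H b \o th).
  have [H01 [L L0 HL]] := lH b; split; first by move=> z; exact: H01.
  exists (L * (e * K)) => [|z z'].
    by rewrite !mulr_ge0// ?(ltW e0)// sumr_ge0// => u _; exact: l1_norm_ge0.
  rewrite (le_trans (HL _ _))// -mulrA ler_wpM2l//.
  have -> : th z - th z' = e *: \sum_u (z 0 u - z' 0 u) *: v u.
    rewrite /th opprD addrACA subrr add0r -scalerBr -sumrB; congr (_ *: _).
    by apply: eq_bigr => u _; rewrite -scalerBl; congr (_ *: _); ring.
  rewrite l1_normZ (gtr0_norm e0) -mulrA ler_pM2l//.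
  have l1_sum (r : seq 'I_m) (w : 'I_m -> 'rV[R]_n) :
      l1_norm (\sum_(u <- r) w u) <= \sum_(u <- r) l1_norm (w u).
    elim: r => [|u r IH]; first by rewrite !big_nil /l1_norm big1// => i _; rewrite mxE normr0.
    by rewrite !big_cons (le_trans (l1_normD _ _))// lerD2l.
  rewrite (le_trans (l1_sum _ _))// mulr_suml; apply: ler_sum => u _.
  rewrite l1_normZ mulrC ler_wpM2l ?l1_norm_ge0// /l1_norm (bigD1 u)//= !mxE lerDl.
  exact: sumr_ge0.
have swapH b : `|A (smooths us (H b \o th)) 0 -
    \prod_i gauss_mean (fun s => ramp (x 0 i + b) e (y 0 i + s))|
    <= (\sum_u C / Num.sqrt (p u)) * e.
  have := swaps m p N us l (H b \o th) pgt0 p1 l2 lam uus (lHth b).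
  have -> : walk_avg p (@unit_vec R m) N (resamples p l us (H b \o th)) 0 =
      \prod_i gauss_mean (fun s => ramp (x 0 i + b) e (y 0 i + s)).
    rewrite -(gauss_avg_prod (chi := fun i => ramp (x 0 i + b) e)
        (ws := [seq Num.sqrt (p u) *: v u | u <- us]))//; last first.
      by move=> i; exact: lip01R_ramp.
    rewrite -[RHS](walk_avg_cst p1 (@unit_vec R m) N _ 0); apply: walk_avg_ext => z.
    rewrite (@resamples_eq R m p l us (H b \o th) z a); last by move=> i; rewrite usT.
    rewrite (resamples_gauss_avg (v := fun u => e *: v u))//; last first.
      by move=> u _; rewrite mxE.
    rewrite tha; congr gauss_avg; apply: eq_map => u.
    by rewrite scalerA sqrtrM ?(ltW l0)// /e mulrAC divff ?mul1r// gt_eqF// sqrtr_gt0.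
  move=> h; apply: (le_trans h); rewrite mulr_suml big_enum/=.
  apply: ler_sum => u _; rewrite sqrtrM ?(ltW l0)// invfM -/e.
  by rewrite mulrA mulrAC.
have cdf_prod (c : 'I_n -> R) : (forall i, `|c i - x 0 i| <= (Y + 1 + K) * e) ->
    `|\prod_i gauss_cdf (c i) - \prod_i gauss_cdf (x 0 i)| <= n%:R * (Y + 1 + K) * e.
  move=> cx; apply: le_trans (prod_dist _ _ _) _ => [i|i|]; try exact: gauss_cdf_itv.
  apply: (@le_trans _ _ (\sum_(i < n) (Y + 1 + K) * e)).
    by apply: ler_sum => i _; rewrite (le_trans (gauss_cdf_lip _ _)).
  by rewrite sumr_const card_ord -[leLHS]mulr_natl mulrA.
have G01 z : 0 <= G z <= 1 by rewrite /G; case: [forall _, _]; rewrite ?ler01 ?lexx.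
(* Smoothing moves [th z] by at most [e * K]: shifting the ramp by that much to
   the right makes the smoothed product of ramps dominate the indicator. *)
have upper : A G 0 <= \prod_i gauss_cdf (x 0 i) +
    (\sum_u C / Num.sqrt (p u) + n%:R * (Y + 1 + K)) * e.
  have GH z : G z <= smooths us (H (e * K) \o th) z.
    have := lip01_smooths us (lHth (e * K)) => -[/(_ z)/andP[s0 _] _].
    rewrite /G; case: forallP => [thx|//]; rewrite (@smooths_const _ _ _ _ 1)// => z' box.
    rewrite /H/= big1// => i _; apply: ramp1 => //.
    have := th_box z z' i; rewrite ler_norml => /(_ _)/andP[|_].
      by move=> u; have := box u; rewrite usT.
    by rewrite lerBlDr addrC => /le_trans; apply; rewrite lerD2r.
  apply: le_trans (walk_avg_le p0 _ _ _ GH) _; rewrite -/A.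
  have := swapH (e * K); rewrite ler_norml => /andP[_].
  have : \prod_i gauss_mean (fun s => ramp (x 0 i + e * K) e (y 0 i + s)) <=
      \prod_i gauss_cdf (x 0 i + e * K + e - y 0 i).
    apply: ler_prod => i _.
    have /andP[h1 ->] := gauss_mean_ramp (x 0 i + e * K) (y 0 i) e0; rewrite andbT.
    by apply: le_trans h1; case/andP: (gauss_cdf_itv (x 0 i + e * K - y 0 i)).
  have := cdf_prod (fun i => x 0 i + e * K + e - y 0 i); rewrite ler_norml => h.
  have /h/andP[_] : forall i, `|x 0 i + e * K + e - y 0 i - x 0 i| <= (Y + 1 + K) * e.
    move=> i; have := yY i; rewrite -/e; rewrite (_ : _ - x 0 i = e * K + e - y 0 i); last by ring.
    have : 0 <= e * K by rewrite mulr_ge0// ?(ltW e0)// sumr_ge0// => u _; exact: l1_norm_ge0.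
    by rewrite !ler_norml; lra.
  by lra.
have lower : \prod_i gauss_cdf (x 0 i) -
    (\sum_u C / Num.sqrt (p u) + n%:R * (Y + 1 + K)) * e <= A G 0.
  (* The ramp must vanish beyond [x 0 i], hence the additional shift by [e]. *)
  pose b := - (e * K) - e.
  have GH z : smooths us (H b \o th) z <= G z.
    have := lip01_smooths us (lHth b) => -[/(_ z)/andP[_ s1] _].
    rewrite /G; case: (boolP [forall i, _]) => [//|].
    rewrite negb_forall => /existsP; case=> i; rewrite -ltNge => thx.
    rewrite (@smooths_const _ _ _ _ 0)// => z' box.
    rewrite /H/= (bigD1 i)//= ramp0 ?mul0r//.
    have := th_box z z' i; rewrite ler_norml => /(_ _)/andP[|h _].
      by move=> u; have := box u; rewrite usT.
    by rewrite /b; lra.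
  apply: le_trans (walk_avg_le p0 _ _ _ GH); rewrite -/A.
  have := swapH b; rewrite ler_norml => /andP[+ _].
  have : \prod_i gauss_cdf (x 0 i + b - y 0 i) <=
      \prod_i gauss_mean (fun s => ramp (x 0 i + b) e (y 0 i + s)).
    apply: ler_prod => i _; case/andP: (gauss_cdf_itv (x 0 i + b - y 0 i)) => -> _.
    by case/andP: (gauss_mean_ramp (x 0 i + b) (y 0 i) e0).
  have := cdf_prod (fun i => x 0 i + b - y 0 i); rewrite ler_norml => h.
  have /h/andP[+ _] : forall i, `|x 0 i + b - y 0 i - x 0 i| <= (Y + 1 + K) * e.
    move=> i; have := yY i; rewrite -/e; rewrite (_ : _ - x 0 i = b - y 0 i); last by ring.
    have : 0 <= e * K by rewrite mulr_ge0// ?(ltW e0)// sumr_ge0// => u _; exact: l1_norm_ge0.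
    by rewrite /b !ler_norml; lra.
  by lra.
by move: upper lower; rewrite ler_norml -/e; lra.
Qed.

End walk_cdf.

(** * The positive definite square root *)

Section posdef.
Context {R : realType}.

Lemma interpolation (f : R -> R) (s : seq R) :
  exists q : {poly R}, forall x, x \in s -> q.[x] = f x.
Proof.
elim: s => [|a s [q qE]]; first by exists 0.
have [as_|aNs] := boolP (a \in s).
  by exists q => x; rewrite inE => /orP[/eqP ->|]; exact: qE.
pose r := \prod_(b <- s) ('X - b%:P).
have rs x : x \in s -> r.[x] = 0.
  by move=> xs; apply/eqP; rewrite -/(root r x) root_prod_XsubC.
have ra : r.[a] != 0 by rewrite -/(root r a) root_prod_XsubC.
exists (q + ((f a - q.[a]) / r.[a])%:P * r) => x.
rewrite hornerD hornerCM inE => /orP[/eqP ->|xs].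
  by rewrite divfK// addrC subrK.
by rewrite (rs x)// mulr0 addr0 qE.
Qed.

Local Notation toC := (real_complex R).
Local Notation MtoC := (map_mx toC).

(** The spectral theorem provides a complex diagonalisation. The real and
    imaginary parts of an eigenvector satisfy the same real eigenvalue equation,
    and one of them is nonzero: this gives the sign of the eigenvalue. *)
Lemma posdef_diag n (A : 'M[R]_n) : posdefmx A ->
  exists (P : 'M[R[i]]_n) (L : 'rV[R]_n), [/\ P \in unitmx,
    forall i, 0 < L 0 i & MtoC A = invmx P *m diag_mx (MtoC L) *m P].
Proof.
move=> [symA posA].
have hA : MtoC A \is hermsymmx.
  apply: realsym_hermsym.
    by apply/is_hermitianmxP; rewrite expr0 scale1r;
      apply/matrixP => i j; rewrite !mxE -[in LHS]symA mxE.
  by apply/mxOverP => i j; rewrite mxE; apply/complex_realP; exists (A i j).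
have /hermitian_normalmx/orthomx_spectralP AE := hA.
have realD := hermitian_spectral_diag_real hA.
move: AE realD; set P := spectralmx _; set D := spectral_diag _ => AE realD.
have Pu : P \in unitmx by exact: spectral_unit.
pose L : 'rV[R]_n := map_mx (@complex.Re R) D.
have LE : MtoC L = D.
  apply/rowP => i; rewrite !mxE; apply: RRe_real.
  by move/mxOverP : realD; apply.
exists P, L; split; [exact: Pu| |by rewrite LE; exact: AE].
clearbody P D => i.
have PA : P *m MtoC A = diag_mx D *m P.
  by rewrite AE !mulmxA mulmxV// mul1mx.
pose u : 'rV[R]_n := map_mx (@complex.Re R) (row i P).
pose v : 'rV[R]_n := map_mx (@complex.Im R) (row i P).
have PiE j : (row i P) 0 j = Complex (u 0 j) (v 0 j).
  by rewrite !mxE; case: (P i j).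
have eigen j : (\sum_k P i k * toC (A k j)) = toC (L 0 i) * P i j.
  have := congr1 (fun M : 'M[R[i]]_n => M i j) PA; rewrite mul_diag_mx mxE.
  under eq_bigr do rewrite mxE.
  by move=> ->; rewrite mxE -LE mxE.
have uA : u *m A = L 0 i *: u.
  apply/rowP => j; rewrite !mxE -/(L 0 i).
  have := congr1 (@complex.Re R) (eigen j); rewrite (raddf_sum (@complex.Re R)).
  rewrite (_ : complex.Re (toC _ * _) = L 0 i * complex.Re (P i j)); last first.
    by case: (P i j) => a b /=; rewrite mul0r subr0.
  rewrite !mxE => <-; apply: eq_bigr => k _; rewrite !mxE.
  by case: (P i k) => a b /=; rewrite mulr0 subr0.
have vA : v *m A = L 0 i *: v.
  apply/rowP => j; rewrite !mxE -/(L 0 i).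
  have := congr1 (@complex.Im R) (eigen j); rewrite (raddf_sum (@complex.Im R)).
  rewrite (_ : complex.Im (toC _ * _) = L 0 i * complex.Im (P i j)); last first.
    by case: (P i j) => a b /=; rewrite mul0r addr0.
  rewrite !mxE => <-; apply: eq_bigr => k _; rewrite !mxE.
  by case: (P i k) => a b /=; rewrite mulr0 add0r.
have pos (w : 'rV[R]_n) : w *m A = L 0 i *: w -> w != 0 -> 0 < L 0 i.
  move=> wA w0; have := posA w w0; rewrite wA -scalemxAl mxE.
  have ww : 0 <= (w *m w^T) 0 0.
    by rewrite mxE sumr_ge0// => k _; rewrite mxE -expr2 sqr_ge0.
  by rewrite !ltNge; apply: contra => L0; exact: mulr_le0_ge0.
have [u0|u0] := eqVneq u 0; last exact: (pos u).
have [v0|v0] := eqVneq v 0; last exact: (pos v).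
have rowi0 : row i P = 0.
  by apply/rowP => j; rewrite PiE u0 v0 !mxE.
have /(congr1 (mulmx^~ (invmx P))) := rowi0.
rewrite rowE mulmxK// mul0mx => /rowP/(_ i).
by rewrite !mxE !eqxx => /eqP; rewrite oner_eq0.
Qed.

(** A real polynomial that interpolates the fourth root at the eigenvalues gives a
    root that is real and symmetric, although the diagonalisation is complex. *)
Lemma posdef_root4 n (A : 'M[R]_n) : posdefmx A ->
  exists T : 'M[R]_n, T^T = T /\ (T *m T) *m (T *m T) = A.
Proof.
case: n A => [|n] A pA; first by exists 0; split; apply/matrixP => -[].
have [P [L [Pu L0 AE]]] := posdef_diag pA.
have [q qE] := interpolation (fun x => Num.sqrt (Num.sqrt x)) [seq L 0 i | i <- enum 'I_n.+1].
pose r : {poly R} := q ^+ 4 - 'X.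
have rL i : r.[L 0 i] = 0.
  rewrite /r !hornerE qE; last by apply: map_f; rewrite mem_enum.
  rewrite (_ : 4 = 2 * 2)%N// exprM sqr_sqrtr ?sqrtr_ge0// sqr_sqrtr ?subrr//.
  exact: ltW.
have rA : horner_mx A r = 0.
  apply: (map_mx_inj (f := toC)); rewrite map_horner_mx AE horner_mx_uconjC//.
  rewrite horner_mx_diag (_ : map_mx _ _ = 0) ?linear0 ?mulmx0 ?mul0mx ?map_mx0//.
  by apply/rowP => i; rewrite !mxE horner_map/= rL rmorph0.
exists (horner_mx A q); split.
  elim/poly_ind: q {qE r rL rA} => [|q c IH]; first by rewrite rmorph0 trmx0.
  rewrite rmorphD rmorphM/= horner_mx_X horner_mx_C linearD/= trmx_mul tr_scalar_mx IH.
  by case: pA => -> _; congr (_ + _); apply: comm_mx_horner.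
have := rA; rewrite /r rmorphB rmorphXn/= horner_mx_X => /eqP.
by rewrite subr_eq0 => /eqP h; rewrite -[RHS]h (exprD _ 2 2) expr2.
Qed.

Lemma posdef_unitmx n (A : 'M[R]_n) : posdefmx A -> A \in unitmx.
Proof.
move=> [_ posA]; rewrite -row_free_unit -kermx_eq0; apply/eqP/row_matrixP => i.
rewrite row0; apply/eqP; apply/contraT => /posA.
have -> : row i (kermx A) *m A = 0 by rewrite -row_mul mulmx_ker row0.
by rewrite mul0mx mxE ltxx.
Qed.

(** The square of a symmetric fourth root is positive definite and not just
    symmetric. *)
Lemma sqrtmxP n (A : 'M[R]_n) : posdefmx A ->
  posdefmx (sqrtmx A) /\ sqrtmx A *m sqrtmx A = A.
Proof.
move=> pA; apply: (@xgetPex _ 0 [set S | posdefmx S /\ S *m S = A]).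
have [T [symT T4]] := posdef_root4 pA.
exists (T *m T); split => //; split; first by rewrite trmx_mul symT.
move=> v v0; have Tu : T \in unitmx.
  by have := posdef_unitmx pA; rewrite -T4 !unitmx_mul => /andP[/andP[]].
rewrite !mulmxA -mulmxA -[T in T *m v^T]symT -trmx_mul mxE.
have vT0 : v *m T != 0.
  by apply: contra v0 => /eqP vT; rewrite -(mulmxK Tu v) vT mul0mx.
rewrite lt_def sumr_ge0 ?andbT; last first.
  by move=> k _; rewrite [(v *m T)^T _ _]mxE -expr2 sqr_ge0.
apply: contra vT0; rewrite psumr_eq0; last first.
  by move=> k _; rewrite [(v *m T)^T _ _]mxE -expr2 sqr_ge0.
move=> /allP h; apply/eqP/rowP => k; have := h k (mem_index_enum _).
by rewrite [(v *m T)^T _ _]mxE mulf_eq0 orbb => /eqP ->; rewrite mxE.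
Qed.

End posdef.

(** * Laws of discrete vectors *)

Section discrete.
Context {R : realType} {dT : measure_display} {T : measurableType dT}.
Variable P : probability T R.
Context {d : nat}.
Local Notation V := 'rV[int]_d.
Implicit Types (Y : T -> V) (A : set V).

(** Enumerating [A] by fibres of [pickle], each empty or a singleton, reduces
    countable additivity on arbitrary sets to the values on singletons. *)
Definition pickle_fiber A k : set V := A `&` [set v | pickle v = k].

Let fiber_bigcup A : A = \bigcup_k pickle_fiber A k.
Proof.
apply/seteqP; split => [v Av|v [k _ []]//].
by exists (pickle v).
Qed.

Lemma pickle_fiberP A k : pickle_fiber A k = set0 \/
  exists2 v, A v & pickle_fiber A k = [set v] /\ pickle v = k.
Proof.
have [[v [Av vk]]|nv] := pselect (exists v, A v /\ pickle v = k); last first.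
  by left; apply/seteqP; split => // v [Av vk]; case: nv; exists v.
right; exists v => //; split => //; apply/seteqP; split => [w [_ /= wk]|w ->//].
by apply: (pcan_inj (@pickleK V)); rewrite wk vk.
Qed.

Let measurable_fiber Y A k : discrete_rv Y -> measurable (Y @^-1` pickle_fiber A k).
Proof.
move=> dY; have [->|[v _ [-> _]]] := pickle_fiberP A k; last exact: dY.
by rewrite preimage_set0.
Qed.

Lemma discrete_measurable Y A : discrete_rv Y -> measurable (Y @^-1` A).
Proof.
move=> dY; rewrite [A]fiber_bigcup preimage_bigcup.
by apply: bigcup_measurable => k _; exact: measurable_fiber.
Qed.

Lemma discrete_series Y A : discrete_rv Y ->
  P (Y @^-1` A) = (\sum_(k <oo) P (Y @^-1` pickle_fiber A k))%E.
Proof.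
move=> dY; rewrite [A in LHS]fiber_bigcup preimage_bigcup measure_semi_bigcup//=.
- by move=> k; exact: measurable_fiber.
- by move=> i j _ _ [w [[_ /= <-] [_ /= <-]]].
- by apply: bigcup_measurable => k _; exact: measurable_fiber.
Qed.

(** Outside a finite set the increment has probability zero, so expectations
    reduce to finite sums. Only values of positive probability are listed: the
    count of each will be standardised by a multiple of [sqrt (p u)]. *)
Lemma bounded_increment_sum (X1 : T -> V) : discrete_rv X1 ->
  bounded_increment P X1 ->
  exists m (B : 'I_m -> V), [/\ injective B,
    forall u, 0 < increment_pmf P X1 (B u),
    forall v, increment_pmf P X1 v = \sum_(u | B u == v) increment_pmf P X1 (B u) &
    forall f : V -> R, fine ('E_P[f \o X1])%E =
      \sum_u increment_pmf P X1 (B u) * f (B u)].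
Proof.
move=> dX [B0 [finB0 _ B0P]]; set p := increment_pmf P X1.
have p_ge0 v : 0 <= p v by exact: fine_ge0.
have pE v : P (X1 @^-1` [set v]) = (p v)%:E.
  by rewrite fineK// fin_num_measure//; exact: dX.
have [s0 sB0] := (finite_seqP _).1 finB0.
pose s := undup [seq v <- s0 | p v != 0].
have us : uniq s by exact: undup_uniq.
have sP v : (v \in s) = (p v != 0).
  rewrite mem_undup mem_filter; case: eqVneq => //= pv; apply: contraT => vs.
  by case/eqP : pv; apply: B0P; rewrite sB0 /=; apply/negP.
pose B (u : 'I_(size s)) : V := nth 0 s u.
have Bs u : B u \in s by exact: mem_nth.
have injB : injective B.
  move=> u u' /eqP; rewrite nth_uniq// => /eqP; exact: val_inj.
have sumB (F : V -> R) : \sum_u F (B u) = \sum_(v <- s) F v.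
  by rewrite (big_nth 0) big_mkord.
exists (size s), B; split => //.
- by move=> u; rewrite lt_def p_ge0 andbT -sP.
- move=> v; have [vs|vs] := boolP (v \in s).
    have vi : (index v s < size s)%N by rewrite index_mem.
    rewrite (bigD1 (Ordinal vi))/= ?/B/= ?nth_index// big1 ?addr0// => u.
    move=> /andP[/eqP uv]; have -> : u = Ordinal vi; last by rewrite eqxx.
    by apply: injB; rewrite /B/= uv nth_index.
  rewrite big1; first by apply/eqP; rewrite -[_ == _]negbK -sP.
  by move=> u /eqP uv; move: vs; rewrite -uv Bs.
move=> f; rewrite unlock.
have mf : measurable_fun setT (f \o X1).
  by move=> _ A mA; rewrite setTI; exact: (discrete_measurable (f @^-1` A)).
pose h (v : V) w := ((f v)%:E * (\1_(X1 @^-1` [set v]) w)%:E)%E.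
have ih v : P.-integrable setT (h v).
  by apply: integrableZl => //; apply: integrable_indic => //; exact: dX.
have null : P (X1 @^-1` (~` [set` s])) = 0.
  rewrite discrete_series// eseries0// => k _ _.
  have [->|[v /= vs [-> _]]] := pickle_fiberP (~` [set` s]) k.
    by rewrite preimage_set0 measure0.
  rewrite pE; congr EFin; apply/eqP; rewrite -[_ == _]negbK -sP.
  by apply/negP.
rewrite (ae_eq_integral (fun w => \sum_(v <- s) h v w)%E)//=.
- rewrite integral_sum//.
  transitivity (fine (\sum_(v <- s) (p v * f v)%:E)%E).
    congr fine; apply: eq_bigr => v _.
    rewrite integralZl; first rewrite integral_indic.
    1: by rewrite setIT EFinM muleC; congr (_ * _)%E; exact: pE.
    all: try exact: measurableT.
    all: try exact: dX.
    by apply: integrable_indic; exact: dX.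
  by rewrite sumEFin/= (sumB (fun v => p v * f v)).
- exact/measurable_EFinP.
- by apply: emeasurable_sum => v; case/integrableP : (ih v).
- exists (X1 @^-1` (~` [set` s])); split => //.
    exact: discrete_measurable.
  move=> w /= hw sw; apply: hw => _; rewrite /h (bigD1_seq (X1 w))//=.
  rewrite indicE mem_set//= mule1 big1 ?adde0// => v vw.
  rewrite indicE memNset ?mule0//= => wv.
  by rewrite wv eqxx in vw.
Qed.

End discrete.

(** * The law of the selected colour *)

Section urn_law.
Context {R : realType} {d m : nat}.
Local Notation V := 'rV[int]_d.
Variables (p U0 : V -> R) (B : 'I_m -> V) (s0 : seq V).
Hypothesis pB : forall v, p v = \sum_(u | B u == v) p (B u).
Hypothesis p_ge0 : forall u, 0 <= p (B u).
Hypothesis U0_ge0 : forall v, 0 <= U0 v.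
Hypothesis us0 : uniq s0.
Hypothesis U0_s0 : forall v, v \notin s0 -> U0 v = 0.

Context {dT : measure_display} {T : measurableType dT} (P : probability T R).
Variables (U : nat -> T -> V -> R) (Z : nat -> T -> V).
Hypothesis urn : infinite_color_urn P p U0 U Z.

Let measurable_comp_discrete (Y : T -> V) (f : V -> R) :
  discrete_rv Y -> measurable_fun setT (f \o Y).
Proof.
by move=> dY _ A mA; rewrite setTI; exact: (discrete_measurable (f @^-1` A)).
Qed.

Let p_bound v : `|p v| <= \sum_u p (B u).
Proof.
rewrite pB (le_trans (ler_norm_sum _ _ _))//.
rewrite [leRHS](bigID (fun u => B u == v))/= -[leLHS]addr0 lerD//.
  by apply: ler_sum => u _; rewrite ger0_norm.
by apply: sumr_ge0.
Qed.

Let U_integrable n v : P.-integrable setT (fun w => (U n w v)%:E).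
Proof.
have bm : measurable_fun setT (fun w => U n w v) /\ exists M, forall w, `|U n w v| <= M.
  elim: n => [|n [mU [M UM]]].
    split; last by exists `|U0 v| => w; rewrite (urn_init urn).
    by rewrite (_ : (fun w => _) = cst (U0 v))//; apply/funext => w; rewrite (urn_init urn).
  have E w : U n.+1 w v = U n w v + p (v - Z n w) by rewrite (urn_update urn).
  split; last first.
    exists (M + \sum_u p (B u)) => w; rewrite E.
    by rewrite (le_trans (ler_normD _ _))// lerD// p_bound.
  rewrite (_ : (fun w => _) = (fun w => U n w v + p (v - Z n w))); last exact/funext.
  apply: measurable_funD => //.
  exact: (measurable_comp_discrete (fun z => p (v - z)) (urn_discrete urn n)).
have [mU [M UM]] := bm.
apply: measurable_bounded_integrable => //.
  by rewrite (le_lt_trans (probability_le1 P measurableT))// ltry.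
by exists M; split; [exact: num_real|move=> x Mx w _; exact: le_trans (UM w) (ltW Mx)].
Qed.

Let select n v : P (Z n @^-1` [set v]) =
  ((n.+1%:R^-1)%:E * \int[P]_w (U n w v)%:E)%E.
Proof.
have [_ /(_ setT)] := urn_select urn n v.
rewrite setTI => ->; last first.
  by rewrite -(setD0 setT); apply: sigma_algebraCD; exact: sigma_algebra0.
rewrite -(integralZl measurableT (U_integrable n v)).
by apply: eq_integral => w _; rewrite -EFinM mulrC.
Qed.

Let shift u n w : V := Z n w + B u.

Let discrete_shift u n : discrete_rv (shift u n).
Proof.
move=> v; rewrite (_ : _ @^-1` _ = Z n @^-1` [set v - B u]); first exact: (urn_discrete urn).
apply/seteqP; split => w /=; rewrite /shift.
  by move=> <-; rewrite addrK.
by move=> ->; rewrite subrK.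
Qed.

(* The urn gains the row of [p] centred at [Z n]: with the weight
   [1 - 1 / (n + 2)] the colour is drawn as at the previous step, and otherwise
   it is [Z n] plus an independent increment. *)
Let select_succ n v : P (Z n.+1 @^-1` [set v]) =
  ((1 - n.+2%:R^-1)%:E * P (Z n @^-1` [set v]) +
   (n.+2%:R^-1)%:E * \sum_u (p (B u))%:E * P (shift u n @^-1` [set v]))%E.
Proof.
rewrite !select.
have -> : (\int[P]_w (U n.+1 w v)%:E = \int[P]_w (U n w v)%:E +
    \sum_u (p (B u))%:E * P (shift u n @^-1` [set v]))%E.
  have iu u : P.-integrable setT (fun w => ((p (B u))%:E * (\1_(shift u n @^-1` [set v]) w)%:E)%E).
    by apply: integrableZl => //; apply: integrable_indic => //; exact: discrete_shift.
  transitivity (\int[P]_w ((U n w v)%:E +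
      \sum_u (p (B u))%:E * (\1_(shift u n @^-1` [set v]) w)%:E))%E.
    apply: eq_integral => w _; rewrite (urn_update urn) EFinD /walk_row pB; congr (_ + _)%E.
    rewrite -sumEFin big_mkcond; apply: eq_bigr => u _; rewrite indicE.
    have [e|e] := eqVneq (B u) (v - Z n w).
      by rewrite mem_set ?mule1//= /shift e addrC subrK.
    rewrite memNset ?mule0//= /shift => e'.
    by move: e; rewrite -e' addrC addKr eqxx.
  rewrite (integralD measurableT (U_integrable n v)); last exact: integrable_sum.
  congr (_ + _)%E; rewrite (integral_sum measurableT iu); apply: eq_bigr => u _.
  rewrite integralZl; first rewrite integral_indic.
  1: by rewrite setIT.
  all: try exact: measurableT.
  all: try exact: discrete_shift.
  by apply: integrable_indic; exact: discrete_shift.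
have fU : (\int[P]_w (U n w v)%:E)%E \is a fin_num.
  exact: integrable_fin_num (U_integrable n v).
have fS : (\sum_u (p (B u))%:E * P (shift u n @^-1` [set v]))%E \is a fin_num.
  apply/sum_fin_numP => u _ _; rewrite fin_numM//.
  by apply: fin_num_measure; exact: discrete_shift.
rewrite muleDr// ?fin_num_adde_defr//; congr (_ + _)%E.
rewrite muleA -EFinM; congr (_%:E * _)%E.
have : 0 < (n.+1%:R : R) by rewrite ltr0n.
rewrite -(natr1 n.+1); move: (n.+1%:R : R) => a a0.
by field; rewrite !gt_eqF// ltr_wpDr.
Qed.

Let law_succ n A : P (Z n.+1 @^-1` A) =
  ((1 - n.+2%:R^-1)%:E * P (Z n @^-1` A) +
   (n.+2%:R^-1)%:E * \sum_u (p (B u))%:E * P (shift u n @^-1` A))%E.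
Proof.
have q0 : 0 <= (n.+2%:R^-1 : R) by rewrite invr_ge0.
have q1 : 0 <= 1 - (n.+2%:R^-1 : R) by rewrite subr_ge0 invf_le1// ler1n.
rewrite !(discrete_series _ _ (urn_discrete urn _)).
under [in RHS]eq_bigr do rewrite (discrete_series _ _ (discrete_shift _ _)).
rewrite -nneseriesZl//.
under [in RHS]eq_bigr do rewrite -nneseriesZl//.
rewrite -nneseries_sum; last by move=> u k _; rewrite mule_ge0// lee_fin.
have S0 k : (0 <= \sum_u (p (B u))%:E * P (shift u n @^-1` pickle_fiber A k))%E.
  by apply: sume_ge0 => u _; rewrite mule_ge0// lee_fin.
rewrite -nneseriesZl// -nneseriesD; last 2 first.
- by move=> k _ _; rewrite mule_ge0// lee_fin.
- by move=> k _ _; rewrite mule_ge0// lee_fin.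
apply: eq_eseriesr => k _; have [->|[v _ [-> _]]] := pickle_fiberP A k; last exact: select_succ.
rewrite !preimage_set0 !measure0 mule0 add0e big1 ?mule0// => u _.
by rewrite mule0.
Qed.

(** The recursion for the law of the selected colour is that of the lazy walk: it
    starts from a colour drawn from [U0] and its [j]-th step is an increment
    with probability [1 / (j + 1)]. *)
Lemma urn_law n A : P (Z n @^-1` A) =
  (\sum_(v0 <- s0) U0 v0 * walk_avg (p \o B) B n \1_A v0)%:E.
Proof.
elim: n A => [|n IH] A /=.
  have P0 v : P (Z 0 @^-1` [set v]) = (U0 v)%:E.
    rewrite select invr1 mul1e.
    under eq_integral do rewrite (urn_init urn).
    rewrite integral_cst// -[RHS]mule1; congr (_ * _)%E; exact: probability_setT.
  rewrite (discrete_series _ _ (urn_discrete urn 0)).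
  transitivity (\sum_(k <oo) \sum_(v0 <- s0) (U0 v0 * \1_(pickle_fiber A k) v0)%:E)%E.
    apply: eq_eseriesr => k _; have [->|[v _ [-> _]]] := pickle_fiberP A k.
      rewrite preimage_set0 measure0 big1// => v _.
      by rewrite indic0 mulr0.
    rewrite P0; have [vs|vs] := boolP (v \in s0).
      rewrite (bigD1_seq v)//= indicE mem_set// mulr1 big1 ?adde0// => v' v'v.
      by rewrite indicE memNset ?mulr0// => /= /eqP; rewrite (negbTE v'v).
    rewrite U0_s0// big_seq big1// => v' v's.
    rewrite indicE memNset ?mulr0//= => v'v.
    by move: vs; rewrite -v'v v's.
  rewrite nneseries_sum; last by move=> v k _; rewrite lee_fin mulr_ge0// indicE.
  rewrite -sumEFin; apply: eq_bigr => v _.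
  rewrite (nneseriesD1 (n := pickle v))//; last first.
    by move=> k _; rewrite lee_fin mulr_ge0// indicE.
  rewrite eseries0 ?adde0; last first.
    move=> k _ /andP[_ kv]; rewrite indicE memNset ?mulr0//= => -[_ /= e].
    by rewrite e eqxx in kv.
  congr (_ * _)%:E; rewrite !indicE; congr (nat_of_bool _)%:R.
  by apply/idP/idP; rewrite !inE; [case|move=> Av; split].
rewrite law_succ IH -EFinM.
have shiftE u : P (shift u n @^-1` A) =
    (\sum_(v0 <- s0) U0 v0 * walk_avg (p \o B) B n \1_A (v0 + B u))%:E.
  rewrite (IH [set v | A (v + B u)]); congr EFin; apply: eq_bigr => v0 _; congr (_ * _).
  rewrite walk_avg_translate; apply: walk_avg_ext => z.
  by rewrite !indicE; congr (nat_of_bool _)%:R.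
rewrite (eq_bigr (fun u => (p (B u) *
    \sum_(v0 <- s0) U0 v0 * walk_avg (p \o B) B n \1_A (v0 + B u))%:E)); last first.
  by move=> u _; rewrite EFinM; congr (_ * _)%E; exact: shiftE.
rewrite sumEFin -EFinM -EFinD; congr EFin.
under [RHS]eq_bigr do rewrite mulrDr.
rewrite big_split/= !mulr_sumr; congr (_ + _).
  by apply: eq_bigr => v _; rewrite mulrCA.
under eq_bigr do rewrite mulrA mulr_sumr.
rewrite exchange_big/=; apply: eq_bigr => v _.
rewrite !mulr_sumr; apply: eq_bigr => u _ /=.
by ring.
Qed.

End urn_law.

(** * Two-sided bound for the ratio *)

Section intensity.
Context {R : realType}.

Lemma ln2_ge : 2^-1 <= ln 2 :> R.
Proof.
have : ln (1 + - 2^-1) <= - 2^-1 :> R.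
  by apply: le_ln1Dx; rewrite ltrN2 invf_lt1// ltr1n.
rewrite (_ : 1 + - 2^-1 = 2^-1 :> R); last by field.
by rewrite lnV ?posrE// lerN2.
Qed.

Lemma ln_nat_ge n : (2 <= n)%N -> 2^-1 <= ln n%:R :> R.
Proof.
move=> n2; apply: (le_trans ln2_ge); rewrite ler_ln ?posrE ?ler_nat// ltr0n.
exact: leq_trans n2.
Qed.

Let lnD (a b : R) : 0 < a -> 0 < b -> ln (a + b) - ln a <= b / a.
Proof.
move=> a0 b0; have ab : 0 < a + b by rewrite addr_gt0.
rewrite -ln_div ?posrE// (_ : (a + b) / a = 1 + b / a); last first.
  by rewrite mulrDl divff// gt_eqF.
by apply: le_ln1Dx; rewrite (lt_trans (ltrN10 _))// divr_gt0.
Qed.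

Lemma walk_intensity_ln n : (1 <= n)%N -> `|walk_intensity n - ln n%:R| <= 1 :> R.
Proof.
move=> n1.
have upper k : walk_intensity k <= ln k.+1%:R :> R.
  rewrite /walk_intensity; elim: k => [|k IH]; first by rewrite big_ord0 ln1.
  rewrite big_ord_recr/=.
  have k0 : 0 < (k.+1%:R : R) by rewrite ltr0n.
  have k1 : 0 < (k.+2%:R : R) by rewrite ltr0n.
  have : ln (1 + - k.+2%:R^-1) <= - k.+2%:R^-1 :> R.
    by apply: le_ln1Dx; rewrite ltrN2 invf_lt1// ltr1n.
  rewrite (_ : 1 + - k.+2%:R^-1 = k.+1%:R / k.+2%:R :> R); last first.
    rewrite -(natr1 k.+1); move: (k.+1%:R : R) k0 => a a0.
    by field; rewrite !gt_eqF// ltr_wpDr.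
  rewrite ln_div ?posrE//; move: IH; move: (\sum_(_ < _) _) (ln _) (ln _) (_^-1) => a b c e.
  lra.
have lower k : ln k.+2%:R - ln 2 <= walk_intensity k :> R.
  rewrite /walk_intensity; elim: k => [|k IH]; first by rewrite big_ord0 subrr.
  rewrite big_ord_recr/=.
  have k1 : 0 < (k.+2%:R : R) by rewrite ltr0n.
  have := lnD k1 ltr01; rewrite natr1 div1r; move: IH.
  move: (\sum_(_ < _) _) (ln _) (ln 2) (ln _) (_^-1) => a b c e f; lra.
have n0 : 0 < (n%:R : R) by rewrite ltr0n.
have h1 := lnD n0 ltr01; rewrite natr1 div1r in h1.
have n11 : n%:R^-1 <= 1 :> R by rewrite invf_le1// ler1n.
have l2 : ln 2 <= 1 :> R.
  by have := @le_ln1Dx R 1; rewrite (_ : 1 + 1 = 2)//; apply; rewrite (lt_trans (ltrN10 _)).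
have : ln n%:R <= ln n.+2%:R :> R by rewrite ler_ln ?posrE ?ltr0n// ler_nat -addn2 leq_addr.
have := upper n; have := lower n; rewrite ler_norml; move: h1 n11 l2.
move: (walk_intensity _) (ln n.+2%:R) (ln n.+1%:R) (ln n%:R) (ln 2) (_^-1).
by move=> a b c e f g; lra.
Qed.

End intensity.

Section det_bounds.
Context {R : realType}.

Lemma posdef_det_gt0 n (A : 'M[R]_n) : posdefmx A -> 0 < \det A.
Proof.
move=> pA; have [_ SS] := sqrtmxP pA.
have := posdef_unitmx pA; rewrite unitmxE unitfE -SS det_mulmx => d0.
by rewrite lt_def d0 -expr2 sqr_ge0.
Qed.

Lemma posdef_principal n (i : 'I_n) (A : 'M[R]_n) : posdefmx A ->
  posdefmx (delmx i i A).
Proof.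
move=> [symA posA]; split.
  by apply/matrixP => a b; rewrite !mxE -[in LHS]symA mxE.
pose E : 'M[R]_(n.-1, n) := rowsub (lift i) 1%:M.
have DE : delmx i i A = E *m A *m E^T.
  apply/matrixP => a b; rewrite -rowsubE !mxE (bigD1 (lift i b))//= !mxE eqxx mulr1.
  rewrite big1 ?addr0// => k kb; rewrite !mxE [lift i b == k]eq_sym (negbTE kb).
  by rewrite mulr0.
have EE : E *m E^T = 1%:M.
  apply/matrixP => a b; rewrite !mxE (bigD1 (lift i b))//= !mxE eqxx mulr1.
  rewrite big1 ?addr0; first by rewrite (inj_eq lift_inj).
  by move=> k kb; rewrite !mxE [lift i b == k]eq_sym (negbTE kb) mulr0.
move=> v v0; rewrite DE !mulmxA -mulmxA -trmx_mul; apply: posA.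
by apply: contra v0 => /eqP vE; rewrite -[v]mulmx1 -EE mulmxA vE mul0mx.
Qed.

(** The determinant is a polynomial in [t], positive on a compact interval. *)
Lemma det_shift_bounds n (A N : 'M[R]_n) :
  (forall t, 0 <= t <= 2^-1 -> posdefmx (A - t *: N)) ->
  exists c C : R, [/\ 0 < c, 0 < C &
    forall t, 0 <= t <= 2^-1 -> c <= \det (A - t *: N) <= C].
Proof.
move=> pos; pose q : {poly R} := \det (map_mx polyC A - 'X *: map_mx polyC N).
have qE t : q.[t] = \det (A - t *: N).
  rewrite -horner_evalE -det_map_mx; congr (\det _).
  by apply/matrixP => i j; rewrite !mxE /= horner_evalE !hornerE.
have cq : {within `[0, 2^-1], continuous (horner q)}.
  by apply: continuous_subspaceT; exact: continuous_horner.
have h2 : 0 <= 2^-1 :> R by [].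
have [a aI qa] := EVT_min h2 cq; have [b bI qb] := EVT_max h2 cq.
have pdet t : 0 <= t <= 2^-1 -> 0 < \det (A - t *: N).
  by move=> /pos; exact: posdef_det_gt0.
exists q.[a], q.[b]; rewrite !qE; split; try exact: pdet.
by move=> t t2; rewrite -!qE qa ?qb.
Qed.

Lemma posdef_shift n (A N : 'M[R]_n) t : posdefmx A -> N^T = N ->
  (forall v : 'rV[R]_n, (v *m N *m v^T) 0 0 <= (v *m A *m v^T) 0 0) ->
  0 <= t <= 2^-1 -> posdefmx (A - t *: N).
Proof.
move=> [symA posA] symN NA /andP[t0 t2]; split.
  by rewrite linearB linearZ/= symA symN.
move=> v v0; have -> : (v *m (A - t *: N) *m v^T) 0 0 =
    (v *m A *m v^T) 0 0 - t * (v *m N *m v^T) 0 0.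
  by rewrite mulmxBr mulmxBl -scalemxAr -scalemxAl [LHS]mxE; congr (_ + _); rewrite !mxE.
have := posA v v0; have := NA v.
move: ((v *m A *m _) _ _) ((v *m N *m _) _ _) => a b ba a0.
have : t * b <= t * a by rewrite ler_wpM2l.
have : t * a <= 2^-1 * a by rewrite ler_wpM2r// ltW.
by move: a0; lra.
Qed.

End det_bounds.

Section ratio.
Context {R : realType} {dT : measure_display} {T : measurableType dT}.
Variables (P : probability T R) (d : nat) (X1 : T -> 'rV[int]_d).
Variables (m : nat) (p : 'I_m -> R) (B : 'I_m -> 'rV[int]_d).
Hypothesis p_gt0 : forall u, 0 < p u.
Hypothesis p_sum1 : \sum_u p u = 1.
Hypothesis E_sum : forall f : 'rV[int]_d -> R,
  fine ('E_P[f \o X1])%E = \sum_u p u * f (B u).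
Hypothesis Sigma_posdef : posdefmx (second_moment_mx P X1).

Let p_ge0 u : 0 <= p u. Proof. exact: ltW. Qed.

Definition inc u : 'rV[R]_d := vec_of_int R (B u).

Lemma mean_vecE : mean_vec P X1 = \sum_u p u *: inc u.
Proof.
apply/rowP => i; rewrite mxE summxE.
rewrite (E_sum (fun v => vec_of_int R v 0 i)).
by apply: eq_bigr => u _; rewrite [RHS]mxE.
Qed.

Lemma second_momentE : second_moment_mx P X1 = \sum_u p u *: ((inc u)^T *m inc u).
Proof.
apply/matrixP => i j; rewrite mxE summxE.
rewrite (E_sum (fun v => ((vec_of_int R v)^T *m vec_of_int R v) i j)).
by apply: eq_bigr => u _; rewrite [RHS]mxE.
Qed.

Let quad (v b : 'rV[R]_d) : (v *m (b^T *m b) *m v^T) 0 0 = ((v *m b^T) 0 0) ^+ 2.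
Proof.
rewrite mulmxA -mulmxA -[b in b *m v^T]trmxK -trmx_mul mxE big_ord1.
by rewrite [((v *m b^T)^T) _ _]mxE expr2.
Qed.

Let mean_mxE : mean_mx P X1 = (mean_vec P X1)^T *m mean_vec P X1.
Proof. by apply/matrixP => i j; rewrite [LHS]mxE [RHS]mxE big_ord1 [_^T _ _]mxE. Qed.

Let quad_second (v : 'rV[R]_d) : (v *m second_moment_mx P X1 *m v^T) 0 0 =
  \sum_u p u * ((v *m (inc u)^T) 0 0) ^+ 2.
Proof.
rewrite second_momentE mulmx_sumr mulmx_suml summxE; apply: eq_bigr => u _.
by rewrite -scalemxAr -scalemxAl mxE quad.
Qed.

Let mean_dot (v : 'rV[R]_d) : (v *m (mean_vec P X1)^T) 0 0 = \sum_u p u * (v *m (inc u)^T) 0 0.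
Proof.
rewrite mean_vecE linear_sum/= mulmx_sumr summxE; apply: eq_bigr => u _.
by rewrite linearZ/= -scalemxAr mxE.
Qed.

Let jensen (x : 'I_m -> R) : (\sum_u p u * x u) ^+ 2 <= \sum_u p u * x u ^+ 2.
Proof.
set a := \sum_u p u * x u.
have : 0 <= \sum_u p u * (x u - a) ^+ 2.
  by apply: sumr_ge0 => u _; rewrite mulr_ge0// sqr_ge0.
rewrite (eq_bigr (fun u => p u * x u ^+ 2 + (- (2 * a) * (p u * x u) + a ^+ 2 * p u))); last first.
  by move=> u _; ring.
rewrite big_split big_split/= -!mulr_sumr p_sum1 -/a mulr1.
by rewrite (_ : _ + a ^+ 2 = - a ^+ 2) ?subr_ge0//; ring.
Qed.

Lemma mean_mx_le (v : 'rV[R]_d) : (v *m mean_mx P X1 *m v^T) 0 0 <=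
  (v *m second_moment_mx P X1 *m v^T) 0 0.
Proof. by rewrite mean_mxE quad quad_second mean_dot; exact: jensen. Qed.

(** At least half of [Sigma] is left, since [Sigma - M] is a covariance matrix. *)
Lemma shifted_posdef t : 0 <= t <= 2^-1 ->
  posdefmx (second_moment_mx P X1 - t *: mean_mx P X1).
Proof.
apply: posdef_shift => //; last exact: mean_mx_le.
by rewrite mean_mxE trmx_mul trmxK.
Qed.

Let t_itv j : (1 <= j)%N -> 0 <= (j.+1%:R^-1 : R) <= 2^-1.
Proof.
by move=> j1; rewrite invr_ge0 ler0n/= lef_pV2 ?posrE ?ltr0n// ler_nat.
Qed.

Lemma shifted_det_bounds : exists c C : R, [/\ 0 < c, 0 < C &
  forall j, (1 <= j)%N -> c <= \det (shifted_mx P X1 j) <= C].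
Proof.
have [c [C [c0 C0 H]]] := det_shift_bounds shifted_posdef.
by exists c, C; split => // j /t_itv; exact: H.
Qed.

Lemma shifted_minor_bounds i : exists c C : R, [/\ 0 < c, 0 < C &
  forall j, (1 <= j)%N -> c <= shifted_minor P X1 i j <= C].
Proof.
have /det_shift_bounds[c [C [c0 C0 H]]] : forall t, 0 <= t <= 2^-1 ->
    posdefmx (delmx i i (second_moment_mx P X1) - t *: delmx i i (mean_mx P X1)).
  move=> t /shifted_posdef/(posdef_principal i).
  by congr posdefmx; apply/matrixP => a b; rewrite !mxE.
by exists c, C; split => // j /t_itv; exact: H.
Qed.

Lemma mean_sq_le i : mean_vec P X1 0 i ^+ 2 <= second_moment_mx P X1 i i.
Proof.
have := mean_mx_le (delta_mx 0 i).
by rewrite trmx_delta -!rowE -!colE !mxE expr2.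
Qed.

Lemma second_moment_gt0 i : 0 < second_moment_mx P X1 i i.
Proof.
have [_ /(_ (delta_mx 0 i))] := Sigma_posdef.
rewrite trmx_delta -rowE -colE !mxE; apply.
by apply/eqP => /rowP/(_ i); rewrite !mxE !eqxx => /eqP; rewrite oner_eq0.
Qed.

Let third_moment t i : R := \sum_u p u * `|inc u 0 i - mean_vec P X1 0 i * t| ^+ 3.

Lemma beta_coefE j i : beta_coef P X1 j i =
  j.+1%:R^-1 * third_moment j.+1%:R^-1 i + j%:R / j.+1%:R ^+ 4 * `|mean_vec P X1 0 i| ^+ 3.
Proof.
rewrite /beta_coef; congr (_ * _ + _).
exact: (E_sum (fun v => `|vec_of_int R v 0 i - mean_vec P X1 0 i / j.+1%:R| ^+ 3)).
Qed.

(** Since [r * (z ^+ 2 - r ^+ 2) <= z ^+ 3], a lower bound for a second moment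
    gives one for the absolute third moment. The second moment of the
    recentred coordinate is at least [(1 - t) ^+ 2 * s], hence [s / 4]. *)
Lemma third_moment_lower i : exists2 k, 0 < k & forall t, 0 <= t <= 2^-1 ->
  k <= third_moment t i.
Proof.
set s := second_moment_mx P X1 i i; have s0 : 0 < s := second_moment_gt0 i.
pose r := Num.sqrt (s / 8); have r0 : 0 < r by rewrite sqrtr_gt0 divr_gt0.
exists (r * (s / 8)); first by rewrite mulr_gt0// divr_gt0.
move=> t /andP[t0 t2]; set mu := mean_vec P X1 0 i.
have r2 : r ^+ 2 = s / 8 by rewrite sqr_sqrtr// divr_ge0// ltW.
have cube0 (z : R) : 0 <= z -> r * (z ^+ 2 - r ^+ 2) <= z ^+ 3.
  move=> z0; have [zr|rz] := leP z r.
    apply: (@le_trans _ _ 0); last exact: exprn_ge0.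
    by rewrite mulr_ge0_le0 ?(ltW r0)// subr_le0 ler_sqr// nnegrE// ltW.
  rewrite exprS mulrBr lerBlDr ler_wpDr// ?mulr_ge0 ?(ltW r0) ?sqr_ge0//.
  by rewrite ler_wpM2r ?sqr_ge0// ltW.
have cube (y : R) : r * (y ^+ 2 - s / 8) <= `|y| ^+ 3.
  by rewrite -r2 -(real_normK (num_real y)); exact: cube0.
have var : s / 4 <= \sum_u p u * (inc u 0 i - mu * t) ^+ 2.
  have -> : \sum_u p u * (inc u 0 i - mu * t) ^+ 2 = s - 2 * t * mu ^+ 2 + t ^+ 2 * mu ^+ 2.
    have sE : s = \sum_u p u * inc u 0 i ^+ 2.
      rewrite /s second_momentE summxE; apply: eq_bigr => u _.
      by rewrite !mxE big_ord1 !mxE expr2.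
    have muE : mu = \sum_u p u * inc u 0 i.
      by rewrite /mu mean_vecE summxE; apply: eq_bigr => u _; rewrite mxE.
    rewrite (eq_bigr (fun u => p u * inc u 0 i ^+ 2 +
      (- (2 * mu * t) * (p u * inc u 0 i) + (mu * t) ^+ 2 * p u))); last first.
      by move=> u _; ring.
    by rewrite big_split big_split/= -!mulr_sumr p_sum1 -sE -muE; ring.
  have ms := mean_sq_le i; rewrite -/s -/mu in ms.
  have : (2 * t - t ^+ 2) * mu ^+ 2 <= (2 * t - t ^+ 2) * s.
    apply: ler_wpM2l => //; rewrite (_ : _ - _ = t * (2 - t)); last by ring.
    by rewrite mulr_ge0//; move: t2; lra.
  have : 4^-1 * s <= (1 - t) ^+ 2 * s.
    rewrite ler_pM2r// (_ : 4^-1 = 2^-1 ^+ 2) ?ler_sqr ?nnegrE//; last by field.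
    - by move: t2; lra.
    - by move: t2; lra.
  rewrite (_ : (1 - t) ^+ 2 * s = s - (2 * t - t ^+ 2) * s); last by ring.
  rewrite (_ : (2 * t - t ^+ 2) * mu ^+ 2 = 2 * t * mu ^+ 2 - t ^+ 2 * mu ^+ 2); last by ring.
  lra.
apply: (@le_trans _ _ (\sum_u p u * (r * ((inc u 0 i - mu * t) ^+ 2 - s / 8)))); last first.
  by apply: ler_sum => u _; rewrite ler_wpM2l.
rewrite (eq_bigr (fun u => r * (p u * (inc u 0 i - mu * t) ^+ 2) - r * (s / 8) * p u)); last first.
  by move=> u _; ring.
rewrite sumrB -!mulr_sumr p_sum1 mulr1 -mulrBr ler_pM2l//.
by move: var; lra.
Qed.

Lemma beta_bounds i : exists k K : R, [/\ 0 < k, 0 < K &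
  forall j, (1 <= j)%N -> k * j.+1%:R^-1 <= beta_coef P X1 j i <= K * j.+1%:R^-1].
Proof.
have [k k0 kE] := third_moment_lower i.
set mu := mean_vec P X1 0 i.
pose K := \sum_u p u * (`|inc u 0 i| + `|mu|) ^+ 3.
have K0 : 0 <= K by apply: sumr_ge0 => u _; rewrite mulr_ge0// exprn_ge0// addr_ge0.
have mu3 : 0 <= `|mu| ^+ 3 by rewrite exprn_ge0.
exists k, (K + `|mu| ^+ 3 + 1); split => //.
  by rewrite ltr_wpDl// addr_ge0.
move=> j j1; rewrite beta_coefE -/mu; have := t_itv j1; set t := _^-1 => /andP[t0 t2].
have j0 : 0 < (j.+1%:R : R) by rewrite ltr0n.
apply/andP; split.
  apply: (@le_trans _ _ (t * third_moment t i)).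
    by rewrite mulrC ler_wpM2l// kE// t0.
  by rewrite lerDl mulr_ge0// divr_ge0// exprn_ge0.
have third : third_moment t i <= K.
  apply: ler_sum => u _; rewrite ler_wpM2l// lerXn2r ?nnegrE ?addr_ge0//.
  rewrite (le_trans (ler_normB _ _))// lerD2l normrM (ger0_norm t0) ler_piMr//.
  by rewrite (le_trans t2)// invf_le1// ler1n.
have jt : j%:R / j.+1%:R ^+ 4 <= t.
  rewrite ler_pdivrMr ?exprn_gt0// exprS mulrA mulVf ?gt_eqF// mul1r.
  by rewrite -natrX ler_nat (leq_trans (leqnSn j))// -[X in (X <= _)%N]expn1 leq_pexp2l.
rewrite mulrDl mul1r mulrDl mulrC -addrA lerD ?ler_wpM2r//.
by rewrite ler_wpDr// mulrC ler_wpM2l.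
Qed.

Variable i1 : 'I_d.

Lemma gamma_bounds : (forall n i, 0 <= gamma_coef P X1 i1 n i) /\
  (forall n, 1 <= gamma_coef P X1 i1 n i1) /\
  exists2 G, 0 <= G & forall n i, gamma_coef P X1 i1 n i <= G.
Proof.
have [c1 [C1 [c10 C10 H1]]] := shifted_minor_bounds i1.
have /choice[C PC] : forall i, exists C, 0 < C /\
    forall j, (1 <= j)%N -> shifted_minor P X1 i j <= C.
  move=> i; have [c [C [c0 C0 H]]] := shifted_minor_bounds i.
  by exists C; split => // j /H/andP[].
split; first by move=> n i; exact: sqrtr_ge0.
split.
  move=> n; rewrite -[leLHS]sqrtr1 ler_wsqrtr//.
  have /andP[h _] := H1 1%N isT.
  apply: le_trans (bigmax_ge_id _ _ _ _).
  by rewrite divff// gt_eqF// (lt_le_trans c10).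
exists (Num.sqrt ((\sum_i C i) / c1)) => // n i; rewrite ler_wsqrtr//.
have ub j : (1 <= j)%N -> shifted_minor P X1 i j / shifted_minor P X1 i1 j <= (\sum_i C i) / c1.
  move=> j1; have /andP[h _] := H1 j j1; have h0 := lt_le_trans c10 h.
  rewrite ler_pdivrMr// mulrAC ler_pdivlMr//.
  have [Ci0 /(_ j j1) Ci] := PC i.
  have CiS : C i <= \sum_i C i.
    by rewrite (bigD1 i)//= lerDl sumr_ge0// => k _; case: (PC k) => /ltW.
  apply: (@le_trans _ _ (C i * c1)); first by rewrite ler_wpM2r// ltW.
  by rewrite ler_pM// ltW.
rewrite big_nat_cond; apply: bigmax_le; first exact: ub.
by move=> j /andP[/andP[j1 _] _]; exact: ub.
Qed.

Let sum_intensity n : \sum_(1 <= j < n.+1) j.+1%:R^-1 = walk_intensity n :> R.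
Proof. by rewrite big_add1/= big_mkord. Qed.

Let sum_bounds n (F : nat -> R) a b :
  (forall j, (1 <= j)%N -> a * j.+1%:R^-1 <= F j <= b * j.+1%:R^-1) ->
  a * walk_intensity n <= \sum_(1 <= j < n.+1) F j <= b * walk_intensity n.
Proof.
move=> H; apply/andP; split; rewrite -sum_intensity mulr_sumr;
  rewrite big_nat_cond [leRHS]big_nat_cond;
  by apply: ler_sum => j /andP[/andP[j1 _] _]; case/andP: (H j j1).
Qed.

Lemma rho2_bounds : exists a b : R, [/\ 0 < a, 0 < b & forall n,
  a * (walk_intensity n / n%:R) <= rho2 P X1 i1 n <= b * (walk_intensity n / n%:R)].
Proof.
have [c0 [C0 [c00 C00 H0]]] := shifted_det_bounds.
have [c1 [C1 [c10 C10 H1]]] := shifted_minor_bounds i1.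
exists (c0 / C1), (C0 / c1); split; try exact: divr_gt0.
move=> n; have e (x : R) : x * (walk_intensity n / n%:R) = n%:R^-1 * (x * walk_intensity n).
  by ring.
rewrite !e /rho2.
suff /andP[h1 h2] : c0 / C1 * walk_intensity n <= \sum_(1 <= j < n.+1) j.+1%:R^-1 *
    (\det (shifted_mx P X1 j) / shifted_minor P X1 i1 j) <= C0 / c1 * walk_intensity n.
  by rewrite !ler_wpM2l// invr_ge0.
apply: sum_bounds => j j1; have /andP[h1 h2] := H1 j j1; have /andP[h3 h4] := H0 j j1.
have hm := lt_le_trans c10 h1; have hd := lt_le_trans c00 h3.
rewrite ![_ * j.+1%:R^-1]mulrC !ler_wpM2l ?invr_ge0//.
- by rewrite ler_pM ?(ltW hd) ?invr_ge0 ?(ltW hm)// lef_pV2 ?posrE.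
- by rewrite ler_pM ?(ltW c00) ?invr_ge0 ?(ltW C10)// lef_pV2 ?posrE.
Qed.

Lemma rho3_bounds : exists k K : R, [/\ 0 < k, 0 < K & forall n,
  k * (walk_intensity n / n%:R) <= rho3 P X1 i1 n <= K * (walk_intensity n / n%:R)].
Proof.
have [g0 [g1 [G G0 gG]]] := gamma_bounds.
have [k [K1 [k0 _ kE]]] := beta_bounds i1.
have /choice[K PK] : forall i, exists K, 0 < K /\
    forall j, (1 <= j)%N -> 0 <= beta_coef P X1 j i <= K * j.+1%:R^-1.
  move=> i; have [k' [K [k'0 K0 H]]] := beta_bounds i.
  exists K; split => // j j1; have /andP[h ->] := H j j1; rewrite andbT.
  by apply: le_trans h; rewrite mulr_ge0// ?(ltW k'0)// invr_ge0.
have d0 : 0 < (d%:R : R) by rewrite ltr0n (leq_ltn_trans _ (ltn_ord i1)).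
pose K3 := \sum_i G ^+ 3 * K i.
have K30 : 0 <= K3.
  by apply: sumr_ge0 => i _; rewrite mulr_ge0 ?exprn_ge0//; case: (PK i) => /ltW.
exists (k / d%:R), ((K3 + 1) / d%:R); split.
- exact: divr_gt0.
- by rewrite divr_gt0// ltr_wpDl.
move=> n.
have e (x : R) : x / d%:R * (walk_intensity n / n%:R) = (n%:R * d%:R)^-1 * (x * walk_intensity n).
  by rewrite invfM; ring.
rewrite !e /rho3.
have nd : 0 <= (n%:R * d%:R : R)^-1 by rewrite invr_ge0 mulr_ge0.
suff /andP[h1 h2] : k * walk_intensity n <= \sum_(1 <= j < n.+1) \sum_(i < d)
    gamma_coef P X1 i1 n i ^+ 3 * beta_coef P X1 j i <= (K3 + 1) * walk_intensity n.
  by rewrite !ler_wpM2l.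
apply: sum_bounds => j j1; apply/andP; split.
  have pos i : 0 <= gamma_coef P X1 i1 n i ^+ 3 * beta_coef P X1 j i.
    by rewrite mulr_ge0 ?exprn_ge0//; case: (PK i) => _ /(_ j j1)/andP[].
  rewrite (bigD1 i1)//= ler_wpDr ?sumr_ge0//.
  have /andP[h _] := kE j j1; apply: (le_trans h).
  rewrite ler_peMl ?exprn_ege1//; by case: (PK i1) => _ /(_ j j1)/andP[].
apply: (@le_trans _ _ (K3 * j.+1%:R^-1)); last by rewrite ler_wpM2r// ?invr_ge0// lerDl.
rewrite /K3 mulr_suml; apply: ler_sum => i _.
have [_ /(_ j j1)/andP[b0 bK]] := PK i.
rewrite -mulrA ler_pM ?exprn_ge0// lerXn2r ?nnegrE//.
Qed.

(** Both [rho2] and [rho3] are between constant multiples of [w / n], where [w] is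
    the walk intensity, and [w] is comparable to [ln n]. *)
Lemma berry_esseen_ratio_bounds : exists k K : R, [/\ 0 < k, 0 < K & forall n, (2 <= n)%N ->
  k / Num.sqrt (ln n%:R) <= berry_esseen_ratio P X1 i1 n <= K / Num.sqrt (ln n%:R)].
Proof.
have [a [b [a0 b0 H2]]] := rho2_bounds.
have [k [K [k0 K0 H3]]] := rho3_bounds.
exists (k / (b * Num.sqrt b) / 2), (K / (a * Num.sqrt a) * 2).
have sa : 0 < Num.sqrt a by rewrite sqrtr_gt0.
have sb : 0 < Num.sqrt b by rewrite sqrtr_gt0.
split; [by rewrite !divr_gt0// mulr_gt0|by rewrite mulr_gt0// divr_gt0// mulr_gt0|].
move=> n n2; set l := ln n%:R; set w := walk_intensity n : R.
have n0 : 0 < (n%:R : R) by rewrite ltr0n; exact: leq_trans n2.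
have l2 : 2^-1 <= l by exact: ln_nat_ge.
have l0 : 0 < l by apply: lt_le_trans l2; rewrite invr_gt0.
have wl : `|w - l| <= 1 by apply: walk_intensity_ln; exact: leq_trans n2.
have w2 : 2^-1 <= w.
  rewrite /w /walk_intensity; case: n n2 {l l2 l0 wl w n0} => // n _.
  by rewrite big_ord_recl/= lerDl sumr_ge0// => j _; rewrite invr_ge0.
have w0 : 0 < w by apply: lt_le_trans w2; rewrite invr_gt0.
have sw : 0 < Num.sqrt w by rewrite sqrtr_gt0.
have sl : 0 < Num.sqrt l by rewrite sqrtr_gt0.
have s4 : Num.sqrt 4 = 2 :> R.
  by rewrite (_ : 4 = 2 ^+ 2 :> R) ?sqrtr_sqr ?ger0_norm// -natrX.
have lw : Num.sqrt l <= 2 * Num.sqrt w.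
  by rewrite -s4 -sqrtrM// ler_wsqrtr//; move: wl w2; rewrite ler_norml; lra.
have wl' : Num.sqrt w <= 2 * Num.sqrt l.
  by rewrite -s4 -sqrtrM// ler_wsqrtr//; move: wl l2; rewrite ler_norml; lra.
pose L := w / n%:R; have L0 : 0 < L by rewrite divr_gt0.
have DE c : 0 < c -> Num.sqrt n%:R * ((c * L) * Num.sqrt (c * L)) = c * Num.sqrt c * L * Num.sqrt w.
  have DE0 (x y z : R) : 0 < x -> 0 < y -> Num.sqrt y * ((x * z) * Num.sqrt (x * z)) =
      x * Num.sqrt x * z * Num.sqrt (y * z).
    by move=> x0 y0; rewrite (sqrtrM _ (ltW x0)) (sqrtrM _ (ltW y0)); ring.
  by move=> c0; rewrite DE0// /L [n%:R * _]mulrC divfK// gt_eqF.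
have /andP[r2a r2b] := H2 n; have /andP[r3k r3K] := H3 n; rewrite -/L in r2a r2b r3k r3K.
have aL : 0 < a * L by rewrite mulr_gt0.
have r20 : 0 < rho2 P X1 i1 n by exact: lt_le_trans r2a.
rewrite /berry_esseen_ratio.
have -> : rho2 P X1 i1 n `^ (3 / 2) = rho2 P X1 i1 n * Num.sqrt (rho2 P X1 i1 n).
  rewrite (_ : 3 / 2 = 1 + 2^-1); last by field.
  rewrite powRD; last by rewrite gt_eqF.
  by rewrite powRr1 ?(ltW r20)// powR12_sqrt// ltW.
set r2 := rho2 P X1 i1 n in r2a r2b r20 *; set r3 := rho3 P X1 i1 n in r3k r3K *.
have Dlow : Num.sqrt n%:R * ((a * L) * Num.sqrt (a * L)) <= Num.sqrt n%:R * (r2 * Num.sqrt r2).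
  by rewrite ler_wpM2l// ler_pM ?(ltW aL)// ler_wsqrtr.
have Dup : Num.sqrt n%:R * (r2 * Num.sqrt r2) <= Num.sqrt n%:R * ((b * L) * Num.sqrt (b * L)).
  by rewrite ler_wpM2l// ler_pM ?(ltW r20)// ler_wsqrtr.
rewrite !DE// in Dlow Dup.
set D := Num.sqrt n%:R * _ in Dlow Dup *.
have D0 : 0 < D by exact: lt_le_trans (mulr_gt0 (mulr_gt0 (mulr_gt0 a0 sa) L0) sw) Dlow.
apply/andP; split.
- rewrite ler_pdivlMr//.
  apply: (@le_trans _ _ (k / (b * Num.sqrt b) / 2 / Num.sqrt l * (b * Num.sqrt b * L * Num.sqrt w))).
    by rewrite ler_wpM2l// !divr_ge0 ?(ltW k0) ?mulr_ge0 ?(ltW b0).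
  apply: le_trans r3k.
  rewrite (_ : _ * (_ * _) = k * L * (Num.sqrt w / (2 * Num.sqrt l))); last first.
    by field; rewrite !gt_eqF.
  apply: ler_piMr; first by exact: mulr_ge0 (ltW k0) (ltW L0).
  by rewrite ler_pdivrMr ?mulr_gt0// mul1r.
- rewrite ler_pdivrMr//; apply: (le_trans r3K).
  apply: (@le_trans _ _ (K / (a * Num.sqrt a) * 2 / Num.sqrt l * (a * Num.sqrt a * L * Num.sqrt w))).
    rewrite (_ : _ * (_ * _) = K * L * (2 * Num.sqrt w / Num.sqrt l)); last first.
      by field; rewrite !gt_eqF.
    apply: ler_peMr; first by exact: mulr_ge0 (ltW K0) (ltW L0).
    by rewrite ler_pdivlMr// mul1r.
  rewrite ler_wpM2l// divr_ge0// mulr_ge0// divr_ge0 ?(ltW K0)// mulr_ge0// ltW//.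
Qed.

End ratio.

(** * The urn *)

Section assembly.
Context {R : realType} (d m : nat) (p : 'I_m -> R) (B : 'I_m -> 'rV[int]_d).
Variables (mu : 'rV[R]_d) (Sg : 'M[R]_d).
Local Notation inc := (@inc R d m B).
Hypothesis Sg_posdef : posdefmx Sg.
Hypothesis p_gt0 : forall u, 0 < p u.
Hypothesis muE : mu = \sum_u p u *: inc u.
Hypothesis SgE : Sg = \sum_u p u *: ((inc u)^T *m inc u).

Definition std_inc u : 'rV[R]_d := inc u *m invmx (sqrtmx Sg).

(** The matrix [Sg] is [\sum_u p u *: (inc u)^T *m inc u], and [sqrtmx Sg] is
    symmetric: standardising by its inverse gives the identity Gram matrix. *)
Lemma gram_std_inc :
  gram [seq Num.sqrt (p u) *: std_inc u | u <- enum 'I_m] =2 (fun j k => (j == k)%:R).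
Proof.
have [pS SS] := sqrtmxP Sg_posdef; have uS := posdef_unitmx pS.
have [symS _] := pS.
set Si := invmx (sqrtmx Sg).
have -> : (fun j k : 'I_d => (j == k)%:R) = (1%:M : 'M[R]_d).
  by apply/funext => j; apply/funext => k; rewrite mxE.
have <- : Si^T *m Sg *m Si = 1%:M.
  rewrite -SS !mulmxA /Si trmx_inv symS mulVmx// mul1mx mulmxV//.
move=> j k; rewrite SgE mulmx_sumr mulmx_suml summxE /gram big_map big_enum/=.
apply: eq_bigr => u _; rewrite /std_inc -/Si.
rewrite -scalemxAr -scalemxAl !mulmxA -trmx_mul -mulmxA !mxE big_ord1 !mxE.
by rewrite mulrACA -expr2 sqr_sqrtr ?(ltW (p_gt0 u)).
Qed.

(** The walk of the colours is an affine image of the walk of the increment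
    counts. *)
Lemma walk_avg_counts n (x : 'rV[R]_d) (v0 : 'rV[int]_d) :
  let l := ln n%:R in
  walk_avg p B n
    \1_[set z | forall i, normalized_color mu Sg n z 0 i <= x 0 i] v0 =
  walk_avg p (@unit_vec R m) n (fun z => [forall i,
    ((Num.sqrt l)^-1 *: (vec_of_int R v0 *m invmx (sqrtmx Sg)) + (Num.sqrt l)^-1 *:
      \sum_u (z 0 u - l * p u) *: std_inc u) 0 i <= x 0 i]%:R) 0.
Proof.
move=> l; set Si := invmx _.
pose G (y : 'rV[R]_d) : R :=
  [forall i, (((Num.sqrt l)^-1 *: (y - l *: mu)) *m Si) 0 i <= x 0 i]%:R.
pose th (z : 'rV[R]_m) := vec_of_int R v0 + \sum_u z 0 u *: inc u.
transitivity (walk_avg p B n (G \o @vec_of_int R d) v0).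
  apply: walk_avg_ext => z; rewrite indicE /= /G; congr (nat_of_bool _)%:R.
  apply/idP/idP; rewrite inE /= => h.
    by apply/forallP => i; exact: h.
  by move=> i; move/forallP : h => /(_ i).
rewrite -(@walk_avg_morph R m p _ _ inc B (@vec_of_int R d)); last first.
  by move=> z u; apply/rowP => i; rewrite !mxE intrD.
have th0 : th 0 = vec_of_int R v0.
  by rewrite /th big1 ?addr0// => u _; rewrite mxE scale0r.
rewrite -th0 (@walk_avg_morph R m p _ _ inc (@unit_vec R m)); last first.
  move=> z u; rewrite /th -addrA; congr (_ + _).
  rewrite (bigD1 u)//= [in RHS](bigD1 u)//= !mxE !eqxx scalerDl scale1r.
  rewrite -!addrA; congr (_ + _); rewrite addrC; congr (_ + _).
  by apply: eq_bigr => w wu; rewrite !mxE eqxx/= (negbTE wu) addr0.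
apply: walk_avg_ext => z; rewrite /G /=; congr (nat_of_bool _)%:R.
apply: eq_forallb => i; congr (fun_of_matrix _ 0 i <= _).
rewrite th0 -[RHS]scalerDr -[LHS]scalemxAl; congr (_ *: _).
rewrite /th muE -addrA mulmxDl; congr (_ + _).
rewrite scaler_sumr -sumrB mulmx_suml; apply: eq_bigr => u _.
by rewrite scalerA -scalerBl -scalemxAl.
Qed.

End assembly.

Lemma eqO_sqrt_ln (R : realType) (f : nat -> R) K :
  (forall n, (2 <= n)%N -> 0 <= f n <= K / Num.sqrt (ln n%:R)) ->
  f =O_\oo (fun n : nat => 1 / Num.sqrt (ln n%:R)).
Proof.
move=> fK; apply/eqO_exP; exists (`|K| + 1); first by rewrite ltr_pwDr.
exists 2%N => // n /= n2; have /andP[f0 f1] := fK n n2.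
have e0 : 0 <= 1 / Num.sqrt (ln n%:R) :> R by rewrite divr_ge0.
rewrite (ger0_norm f0) (ger0_norm e0); apply: (le_trans f1).
by rewrite mul1r ler_wpM2r ?invr_ge0// ler_wpDr// ler_norm.
Qed.

(* [X j] is the (j+1)-st increment, so [X 0] plays the role of X_1. *)
Theorem theorem4 (R : realType) (d : nat) (hd : (2 <= d)%N)
    (dX : measure_display) (TX : measurableType dX) (PX : probability TX R)
    (X : nat -> TX -> 'rV[int]_d) (X_iid : iid PX X)
    (X_bounded : bounded_increment PX (X 0%N))
    (Sigma_posdef : posdefmx (second_moment_mx PX (X 0%N)))
    (U0 : 'rV[int]_d -> R) (U0_init : initial_configuration U0)
    (U0_finite : finite_set [set v | U0 v != 0]) :
  let i1 : 'I_d := Ordinal (ltnW hd) in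
  let ratio := berry_esseen_ratio PX (X 0%N) i1 in
  (exists C : R, 0 < C /\
    forall (dT : measure_display) (T : measurableType dT)
      (P : probability T R) (U : nat -> T -> 'rV[int]_d -> R)
      (Z : nat -> T -> 'rV[int]_d),
    infinite_color_urn P (increment_pmf PX (X 0%N)) U0 U Z ->
    forall n : nat, (2 <= n)%N ->
    (ereal_sup [set (`| fine (P [set w | forall i : 'I_d,
          (normalized_color (mean_vec PX (X 0%N))
             (second_moment_mx PX (X 0%N)) n (Z n w)) 0 i <= x 0 i])
        - std_normal_cdf x |)%:E | x in [set: 'rV[R]_d]]
      <= (C * ratio n)%:E)%E) /\
  ratio =O_\oo (fun n : nat => 1 / Num.sqrt (ln n%:R)).
Proof.
move=> i1 ratio; have [dX0 _ _] := X_iid.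
have [m [B [injB p_gt0 pB E_sum]]] := bounded_increment_sum (dX0 0%N) X_bounded.
set p := increment_pmf PX (X 0%N) in p_gt0 pB E_sum *.
pose q u := p (B u).
have q_sum1 : \sum_u q u = 1.
  have := E_sum (cst 1); rewrite (_ : cst 1 \o X 0%N = cst 1)// expectation_cst/=.
  by under eq_bigr do rewrite mulr1.
have [k [K [k0 K0 ratioE]]] := berry_esseen_ratio_bounds p_gt0 q_sum1 E_sum Sigma_posdef i1.
split; last first.
  apply: (@eqO_sqrt_ln _ _ K) => n n2; have /andP[h1 ->] := ratioE n n2.
  by rewrite andbT; apply: le_trans h1; rewrite divr_ge0// ltW.
set Sg := second_moment_mx _ _ in Sigma_posdef *; set mu := mean_vec _ _.
have [C0 C00 cdf] := @walk_cdf R.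
have [s0 s0E] := (finite_seqP _).1 U0_finite.
pose s := undup s0.
have sP v : v \notin s -> U0 v = 0.
  rewrite mem_undup => vs; apply/eqP; apply: contraT => v0.
  have : [set` s0] v by rewrite -s0E.
  by rewrite /= (negbTE vs).
have [U0_ge0 _] := U0_init.
pose v u := std_inc B Sg u.
pose Y := \sum_(v0 <- s) l1_norm (vec_of_int R v0 *m invmx (sqrtmx Sg)).
pose D := \sum_u C0 / Num.sqrt (q u) + d%:R * (Y + 1 + \sum_u l1_norm (v u)).
have Y0 : 0 <= Y by apply: sumr_ge0 => v0 _; exact: l1_norm_ge0.
have D0 : 0 < D.
  rewrite ltr_wpDl//; first by apply: sumr_ge0 => u _; rewrite divr_ge0// ltW.
  rewrite mulr_gt0 ?ltr0n ?(leq_trans _ hd)// ltr_wpDr ?ltr_wpDl//.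
  by apply: sumr_ge0 => u _; exact: l1_norm_ge0.
(* [k] is the constant of the lower bound for [ratio]. *)
exists (D / k); split; first exact: divr_gt0.
move=> dT T P U Z urn n n2; pose l : R := ln n%:R.
have l2 : 2^-1 <= l by exact: ln_nat_ge.
have l0 : 0 < l by apply: lt_le_trans l2; rewrite invr_gt0.
have law := urn_law pB (fun u => ltW (p_gt0 u)) U0_ge0 (undup_uniq s0) sP urn.
have U0_sum1 : \sum_(v0 <- s) U0 v0 = 1.
  have := law 0%N setT; rewrite preimage_setT probability_setT => -[->].
  by apply: eq_bigr => v0 _; rewrite /= indicT mulr1.
apply: ge_ereal_sup => _ [x _ <-]; rewrite lee_fin.
have -> : [set w | forall i, normalized_color mu Sg n (Z n w) 0 i <= x 0 i] =
    Z n @^-1` [set z | forall i, normalized_color mu Sg n z 0 i <= x 0 i] by [].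
rewrite law/=.
have -> : std_normal_cdf x = \sum_(v0 <- s) U0 v0 * \prod_i gauss_cdf (x 0 i).
  by rewrite -mulr_suml U0_sum1 mul1r.
rewrite -sumrB; apply: le_trans (ler_norm_sum _ _ _) _.
apply: (@le_trans _ _ (\sum_(v0 <- s) U0 v0 * (D / Num.sqrt l))); last first.
  rewrite -mulr_suml U0_sum1 mul1r mulrAC ler_pdivlMr// -mulrA ler_pM2l//.
  by rewrite mulrC; have /andP[] := ratioE n n2.
rewrite big_seq [leRHS]big_seq; apply: ler_sum => v0 v0s.
rewrite -mulrBr normrM ger0_norm// ler_wpM2l//.
rewrite (@walk_avg_counts R d m q B mu Sg (mean_vecE E_sum)).
apply: cdf => //.
- exact: gram_std_inc Sigma_posdef p_gt0 (second_momentE E_sum).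
- by apply: walk_intensity_ln; exact: leq_trans n2.
- move=> i; have e0 : 0 <= (Num.sqrt l)^-1 by rewrite invr_ge0.
  rewrite mxE mulrC normrM (ger0_norm e0) ler_wpM2r//.
  apply: (@le_trans _ _ (l1_norm (vec_of_int R v0 *m invmx (sqrtmx Sg)))).
    by rewrite /l1_norm (bigD1 i)//= lerDl sumr_ge0.
  rewrite /Y (bigD1_seq v0) ?undup_uniq//= lerDl sumr_ge0// => v' _.
  exact: l1_norm_ge0.
Qed.
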